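(* Let $a<0$ and $\mu=\frac{1}{1-a}\in(0,1)$. Define $$\bar\Omega_a(X)=-\sin(\pi\mu)\,\frac{\mathbf 1_{\{X>1\}}}{|1-X|^{\mu}},\qquad \bar c_{l,a}=1-a,\qquad \bar c_{\omega,a}=-1.$$ Then $\mathcal H(\bar\Omega_a)(X)=\frac{\mathbf 1_{\{X<1\}}+\mathbf 1_{\{X>1\}}\cos(\pi\mu)}{|1-X|^{\mu}}$, and with $\bar U_a(X)=\int_0^X\mathcal H(\bar\Omega_a)(Y)\,dY$, the triple $(\bar\Omega_a,\bar c_{l,a},\bar c_{\omega,a})$ solves the self-similar profile equation $$(\bar c_{l,a}X+a\bar U_a)\,(\bar\Omega_a)_X=(\bar c_{\omega,a}+(\bar U_a)_X)\,\bar\Omega_a$$ at every $X\ne1$.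
   Context: $\mathcal H$ denotes the Hilbert transform on $\mathbb R$: $\mathcal H(f)(x)=\frac1\pi\,\mathrm{P.V.}\int_{\mathbb R}\frac{f(y)}{x-y}\,dy$. $\mathbf 1_{A}$ is the indicator of the set $A$. *)

(* Defs.v *)
From HB Require Import structures.
From mathcomp Require Import all_boot all_order all_algebra.
From mathcomp Require Import all_classical all_reals all_analysis.
Set Implicit Arguments. Unset Strict Implicit. Unset Printing Implicit Defensive.
Import Order.TTheory GRing.Theory Num.Theory.
Import numFieldNormedType.Exports.
Local Open Scope classical_set_scope.
Local Open Scope ring_scope.

Definition hilbert_trunc (R : realType) (f : R -> R) (x eps : R) : R :=
  pi^-1 * Rintegral lebesgue_measure [set y : R | eps < `|x - y|]
                    (fun y => f y / (x - y)).

Definition is_hilbert (R : realType) (f : R -> R) (x v : R) : Prop :=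
  (forall eps : R, 0 < eps ->
     lebesgue_measure.-integrable [set y : R | eps < `|x - y|]
       (fun y => (f y / (x - y))%:E)) /\
  hilbert_trunc f x eps @[eps --> 0^'+] --> v.

Definition hilbert (R : realType) (f : R -> R) (x : R) : R :=
  lim (hilbert_trunc f x eps @[eps --> 0^'+]).

Definition oint (R : realType) (g : R -> R) (a b : R) : R :=
  if a <= b then Rintegral lebesgue_measure `[a, b] g
  else - Rintegral lebesgue_measure `[b, a] g.

Definition Omega_bar (R : realType) (a : R) (X : R) : R :=
  let mu := (1 - a)^-1 in
  - sin (pi * mu) * ((if 1 < X then 1 else 0) / (`|1 - X| `^ mu)).

Definition U_bar (R : realType) (a : R) (X : R) : R :=
  oint (hilbert (Omega_bar a)) 0 X.

(* Main.v *)
(* Translation and homogeneity reduce the Hilbert transform of the truncated power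
   x_+^(-m) to the points 1 and -1, hence to the integrals of t^(-m) / (1 - t) and
   t^(-m) / (t + 1) over ]0, +oo[.  The function [ibeta a], a primitive of
   t^(a-1) / (1 - t) on ]0, 1[ vanishing at 0, yields primitives of both integrands, so
   that the two integrals are combinations of the constants
   [ibeta_lim1 a] = lim_(x -> 1-) (ibeta a x + ln (1 - x)).  They are evaluated by
   ibeta_lim1 m - ibeta_lim1 (1 - m) = pi cot (pi m): both sides satisfy
   2 h(x) = h(x/2) + h((x+1)/2), and their difference is Lipschitz on ]0, 1[, hence
   constant, hence zero by antisymmetry about 1/2.  U_bar is then explicit by the
   fundamental theorem of calculus, and c_l X + a U_bar = c_l (X - 1) (1 - H Omega_bar)
   turns the profile equation into an algebraic identity. *)

Require Import Defs.
From HB Require Import structures.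
From mathcomp Require Import all_boot all_order all_algebra.
From mathcomp Require Import all_classical all_reals all_analysis.
From mathcomp Require Import measurable_realfun ring lra.
Import Order.TTheory GRing.Theory Num.Theory.
Import numFieldNormedType.Exports.
Local Open Scope classical_set_scope.
Local Open Scope ring_scope.

Set Implicit Arguments.
Unset Strict Implicit.

(** * Derivatives, power series and one-sided limits *)

Section derivatives.
Context {R : realType}.
Implicit Types (f g : R -> R) (x : R).

(* The library's rules are stated for pointwise operations on functions, which do
   not unify with abstractions such as [fun t => f t * g t]. *)
Lemma is_derive1D f g x a b : is_derive x 1 f a -> is_derive x 1 g b ->
  is_derive x 1 (fun t => f t + g t) (a + b).
Proof. by move=> df dg; exact: is_deriveD. Qed.

Lemma is_derive1B f g x a b : is_derive x 1 f a -> is_derive x 1 g b ->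
  is_derive x 1 (fun t => f t - g t) (a - b).
Proof. by move=> df dg; exact: is_deriveB. Qed.

Lemma is_derive1M f g x a b : is_derive x 1 f a -> is_derive x 1 g b ->
  is_derive x 1 (fun t => f t * g t) (a * g x + f x * b).
Proof.
move=> df dg; have h := is_deriveM df dg.
by apply: is_derive_eq; rewrite addrC /GRing.scale/= [g x * a]mulrC.
Qed.

Lemma is_derive1Zl f (k : R) x a :
  is_derive x 1 f a -> is_derive x 1 (fun t => k * f t) (k * a).
Proof. by move=> df; exact: is_deriveZ. Qed.

Lemma is_derive1V f x a : f x != 0 ->
  is_derive x 1 f a -> is_derive x 1 (fun t => (f t)^-1) (- a / f x ^+ 2).
Proof.
by move=> fx df; apply: is_derive_eq (is_deriveV fx df) _; rewrite scaleNr mulNr mulrC.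
Qed.

Lemma is_derive1_chain f g x a b : is_derive (g x) 1 f a ->
  is_derive x 1 g b -> is_derive x 1 (fun t => f (g t)) (a * b).
Proof. by move=> df dg; exact: is_derive1_comp. Qed.

Lemma is_derive1_addr (c x : R) : is_derive x 1 (fun t => t + c) 1.
Proof.
by rewrite -[X in is_derive _ _ _ X]addr0; exact: is_derive1D (is_derive_cst _ _ _).
Qed.

Lemma is_derive1_onem x : is_derive x 1 (fun t => 1 - t) (- 1).
Proof.
by rewrite -[X in is_derive _ _ _ X]add0r; exact: is_derive1B (is_derive_cst _ _ _) _.
Qed.

Lemma is_derive1_sqr x : is_derive x 1 (fun t => t ^+ 2) (2 * x).
Proof.
by apply: is_derive_eq (is_derive1M (is_derive_id x 1) (is_derive_id x 1)) _; ring.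
Qed.

Lemma is_derive1_continuous f x a : is_derive x 1 f a -> {for x, continuous f}.
Proof. by move=> df; exact/differentiable_continuous/derivable1_diffP. Qed.

Lemma is_derive1_derive1 f x a : is_derive x 1 f a -> derive1 f x = a.
Proof. by move=> df; rewrite derive1E derive_val. Qed.

Lemma is_derive_ge0_homo f df a b :
  (forall x, a < x < b -> is_derive x 1 f (df x)) ->
  (forall x, a < x < b -> 0 <= df x) -> {in `]a, b[ &, {homo f : x y / x <= y}}.
Proof.
move=> fdf df0; apply: ger0_derive1_le_oo => x; rewrite ?inE/= ?in_itv/= => xab.
- by have ? := fdf x xab; exact: ex_derive.
- by rewrite (is_derive1_derive1 (fdf x xab)) df0.
- exact: is_derive1_continuous (fdf x xab).
Qed.

Lemma is_derive_le f g df dg a b (l : R) :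
  (forall x, a < x < b -> is_derive x 1 f (df x)) ->
  (forall x, a < x < b -> is_derive x 1 g (dg x)) ->
  (forall x, a < x < b -> df x <= dg x) ->
  f x @[x --> a^'+] --> l -> g x @[x --> a^'+] --> l ->
  forall x, a < x < b -> f x <= g x.
Proof.
move=> fdf gdg dfg fa ga x /andP[ax xb]; rewrite -subr_ge0.
have homoB : {in `]a, b[ &, {homo (fun t => g t - f t) : x y / x <= y}}.
  apply: (is_derive_ge0_homo (df := fun y => dg y - df y)) => y yab.
    exact: is_derive1B (gdg y yab) (fdf y yab).
  by rewrite subr_ge0 dfg.
have B0 : g y - f y @[y --> a^'+] --> 0.
  by rewrite -[X in _ --> X](subrr l); exact: cvgB.
apply: (cvgr_to_le B0); near=> y; apply: homoB; rewrite ?in_itv/= ?ax//.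
  by apply/andP; split => //; apply: lt_trans xb; near: y; exact: nbhs_right_lt.
by near: y; exact: nbhs_right_le.
Unshelve. all: by end_near. Qed.

Lemma is_derive_unique f g df a b (l : R) :
  (forall x, a < x < b -> is_derive x 1 f (df x)) ->
  (forall x, a < x < b -> is_derive x 1 g (df x)) ->
  f x @[x --> a^'+] --> l -> g x @[x --> a^'+] --> l ->
  forall x, a < x < b -> f x = g x.
Proof.
move=> fdf gdf fa ga x xab; apply/eqP; rewrite eq_le.
by rewrite (is_derive_le fdf gdf _ fa ga)// (is_derive_le gdf fdf _ ga fa).
Qed.

Lemma is_derive_lipschitz f df a b (k : R) :
  (forall x, a < x < b -> is_derive x 1 f (df x)) ->
  (forall x, a < x < b -> `|df x| <= k) ->
  forall x y, a < x < b -> a < y < b -> `|f x - f y| <= k * `|x - y|.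
Proof.
move=> fdf dfk x y; wlog xy : x y / x <= y => [hwlog xab yab|].
  have [/hwlog|/ltW/hwlog] := leP x y; first exact.
  by rewrite distrC [`|x - y|]distrC; exact.
move=> /andP[ax xb] /andP[ay yb].
have dfz z : x <= z <= y -> is_derive z 1 f (df z).
  by move=> /andP[xz zy]; apply: fdf; rewrite (lt_le_trans ax)//= (le_lt_trans zy).
have [z||c] := @MVT_segment _ f df _ _ xy.
- by rewrite in_itv/= => /andP[? ?]; apply: dfz; rewrite !ltW.
- apply: derivable_within_continuous => z; rewrite in_itv/= => /dfz ?.
  exact: ex_derive.
rewrite in_itv/= => /andP[xc cy] fyx; rewrite distrC fyx normrM [`|x - y|]distrC.
by rewrite ler_wpM2r// dfk// (lt_le_trans ax)//= (le_lt_trans cy).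
Qed.

End derivatives.

Section pseries.
Context {R : realType}.
Implicit Types (c : R^nat) (x K : R).

Lemma mul_succ_expr_le n x K : 0 <= x -> x <= K ->
  n.+1%:R * x ^+ n * (K - x) <= K ^+ n.+1.
Proof.
move=> x0 xK; have K0 := le_trans x0 xK.
rewrite mulrC (@le_trans _ _ (K ^+ n.+1 - x ^+ n.+1))// ?gerBl ?exprn_ge0//.
rewrite subrXX ler_wpM2l ?subr_ge0// mulr_natl -[n.+1 in leLHS]card_ord -sumr_const.
apply: ler_sum => i _; rewrite /= -[n in leLHS](subnK (ltnSE (ltn_ord i))) exprD.
by rewrite ler_wpM2r ?exprn_ge0// lerXn2r// nnegrE.
Qed.

Lemma is_cvg_pseries_diffs c x K : cvgn (pseries c K) -> `|x| < `|K| ->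
  cvgn (pseries (pseries_diffs c) x).
Proof.
move=> cK xK; pose r : R := (`|x| + `|K|) / 2.
have xr : `|x| < r by rewrite /r; lra.
have r0 : 0 < r by rewrite (le_lt_trans _ xr).
have rK : `|r| < `|K| by rewrite gtr0_norm// /r; lra.
apply: normed_cvg; apply: (@series_le_cvg _ _
    (fun n => (r - `|x|)^-1 * (`|c n.+1| * r ^+ n.+1))) => [n|n|n|] /=.
- exact: normr_ge0.
- by rewrite !mulr_ge0 ?invr_ge0 ?subr_ge0 ?exprn_ge0// ltW.
- rewrite ler_pdivlMl ?subr_gt0// /pseries_diffs !normrM normrX normr_nat.
  rewrite mulrC [n.+1%:R * _]mulrC -!mulrA [n.+1%:R * _]mulrA.
  by rewrite ler_wpM2l// mul_succ_expr_le// ltW.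
apply: is_cvg_seriesZ.
have := is_cvg_pseries_inside_norm cK rK.
rewrite -(is_cvg_series_restrict 1) => /cvg_ex[/= l]; rewrite -cvg_shiftS/= => gl.
by apply/cvg_ex; exists l; move: gl; under eq_fun do rewrite big_add1.
Qed.

Lemma is_derive_pseries c x K : cvgn (pseries c K) -> `|x| < `|K| ->
  is_derive x 1 (fun t => limn (pseries c t)) (limn (pseries (pseries_diffs c) x)).
Proof.
move=> cK xK; have := normr_ge0 x => x0.
pose r1 : R := (2 * `|x| + `|K|) / 3; pose r2 : R := (`|x| + 2 * `|K|) / 3.
have r1E : `|r1| = r1 by rewrite ger0_norm// /r1; lra.
have r2E : `|r2| = r2 by rewrite ger0_norm// /r2; lra.
have cdr2 : cvgn (pseries (pseries_diffs c) r2).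
  by apply: is_cvg_pseries_diffs cK _; rewrite r2E /r2; lra.
apply: (@pseries_snd_diffs _ _ r1).
- by apply: is_cvg_pseries_inside cK _; rewrite r1E /r1; lra.
- by apply: is_cvg_pseries_inside cdr2 _; rewrite r1E r2E /r1 /r2; lra.
- by apply: is_cvg_pseries_diffs cdr2 _; rewrite r1E r2E /r1 /r2; lra.
- by rewrite r1E /r1; lra.
Qed.

End pseries.

Section one_sided_limits.
Context {R : realType} {T : Type} {F : set_system T} {FF : Filter F}.
Implicit Types (f : R -> R) (g : T -> R) (b l : R).

Lemma cvg_comp_at_right g f b l : g @ F --> b -> (\forall x \near F, b < g x) ->
  f x @[x --> b^'+] --> l -> f (g x) @[x --> F] --> l.
Proof.
move=> gb gtb fl; apply: (@cvg_comp _ _ _ g f _ b^'+) => //.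
move=> A bA; apply: filterS2 gtb (gb _ bA) => x gx; exact.
Qed.

Lemma cvg_comp_at_left g f b l : g @ F --> b -> (\forall x \near F, g x < b) ->
  f x @[x --> b^'-] --> l -> f (g x) @[x --> F] --> l.
Proof.
move=> gb gtb fl; apply: (@cvg_comp _ _ _ g f _ b^'-) => //.
move=> A bA; apply: filterS2 gtb (gb _ bA) => x gx; exact.
Qed.

End one_sided_limits.

Section one_sided_neighborhoods.
Context {R : realType}.
Implicit Types (f g : R -> R) (P : R -> Prop) (a b l : R).

Lemma near_at_left_oo P a b : a < b -> (forall x, a < x < b -> P x) ->
  \forall x \near b^'-, P x.
Proof.
by move=> ab Pab; near=> x; apply: Pab; apply/andP; split.
Unshelve. all: by end_near. Qed.

Lemma near_at_right_oo P a b : a < b -> (forall x, a < x < b -> P x) ->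
  \forall x \near a^'+, P x.
Proof.
by move=> ab Pab; near=> x; apply: Pab; apply/andP; split.
Unshelve. all: by end_near. Qed.

Lemma eq_cvg_at_left f g a b l : a < b -> (forall x, a < x < b -> f x = g x) ->
  f x @[x --> b^'-] --> l -> g x @[x --> b^'-] --> l.
Proof.
by move=> ab fg; apply: cvg_trans; apply: near_eq_cvg; exact: near_at_left_oo ab fg.
Qed.

Lemma eq_cvg_at_right f g a b l : a < b -> (forall x, a < x < b -> f x = g x) ->
  f x @[x --> a^'+] --> l -> g x @[x --> a^'+] --> l.
Proof.
by move=> ab fg; apply: cvg_trans; apply: near_eq_cvg; exact: near_at_right_oo ab fg.
Qed.

Lemma cvg_comp_sqr_at_right0 f l : f x @[x --> 0^'+] --> l ->
  f (x ^+ 2) @[x --> 0^'+] --> l.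
Proof.
apply: cvg_comp_at_right; last by near=> x; rewrite exprn_gt0.
rewrite -[X in _ --> X](expr0n _ 2); apply: cvg_at_right_filter.
exact: exprn_continuous.
Unshelve. all: by end_near. Qed.

Lemma cvg_comp_sqr_at_left1 f l : f x @[x --> 1^'-] --> l ->
  f (x ^+ 2) @[x --> 1^'-] --> l.
Proof.
apply: cvg_comp_at_left.
  rewrite -[X in _ --> X](expr1n _ 2); apply: cvg_at_left_filter.
  exact: exprn_continuous.
by apply: (near_at_left_oo ltr01) => x /andP[x0 x1]; rewrite expr_lt1// ltW.
Qed.

End one_sided_neighborhoods.

(** * Lebesgue integrals: change of variable and improper integrals *)

Section affine_change_of_variable.
Context {R : realType}.
Variables k c : R.
Hypothesis k_neq0 : k != 0.
Notation mu := (@lebesgue_measure R).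
Notation affine := (fun x : measurableTypeR R => (k * x + c)%R : measurableTypeR R).

Let measurable_affine : measurable_fun [set: measurableTypeR R] affine.
Proof. by apply: measurable_funD => //; exact: measurable_funM. Qed.

Lemma measurable_preimage_affine (D : set R) : measurable D ->
  measurable (affine @^-1` D).
Proof. by move=> mD; rewrite -[_ @^-1` _]setTI; exact: measurable_affine. Qed.

Lemma lebesgue_measure_affine (A : set R) : measurable A ->
  mu A = (`|k|%:E * mu (affine @^-1` A))%E.
Proof.
apply: (@lebesgue_measure_unique R (mscale `|k|%:nng (pushforward mu affine))).
move=> _ [[a b]] _ <-; transitivity (`|k|%:E * mu (affine @^-1` `]a, b]%classic))%E => //.
rewrite lebesgue_measure_itv/= lte_fin.
have [k0|k0|] := ltgtP k 0; last by move/eqP: k_neq0.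
- have -> : affine @^-1` `]a, b]%classic = [set` `[(b - c) / k, (a - c) / k[].
    by apply/seteqP; split => x /=; rewrite !in_itv/= ltr_ndivlMr// ler_ndivrMr//;
      rewrite ltrBlDr lerBrDr mulrC andbC.
  rewrite lebesgue_measure_itv/= lte_fin ltr_nM2r ?invr_lt0// ltrD2r.
  case: ifP => _; last by rewrite mule0.
  by rewrite -!EFinD -EFinM ltr0_norm//; congr (_%:E); field.
- have -> : affine @^-1` `]a, b]%classic = [set` `](a - c) / k, (b - c) / k]].
    by apply/seteqP; split => x /=; rewrite !in_itv/= ltr_pdivrMr// ler_pdivlMr//;
      rewrite ltrBlDr lerBrDr mulrC.
  rewrite lebesgue_measure_itv/= lte_fin ltr_pM2r ?invr_gt0// ltrD2r.
  case: ifP => _; last by rewrite mule0.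
  by rewrite -!EFinD -EFinM gtr0_norm//; congr (_%:E); field.
Qed.

Lemma ge0_integral_affine (D : set R) (f : R -> \bar R) : measurable D ->
  measurable_fun D f -> (forall x, D x -> 0 <= f x)%E ->
  (\int[mu]_(x in D) f x = `|k|%:E * \int[mu]_(x in affine @^-1` D) f (affine x))%E.
Proof.
move=> mD mf f0.
rewrite (eq_measure_integral (mscale `|k|%:nng (pushforward mu affine))) => [|A mA _].
  rewrite ge0_integral_mscale// ge0_integral_pushforward//.
  by move=> x /set_mem; exact: f0.
exact: lebesgue_measure_affine.
Qed.

Lemma integrable_affine (D : set R) (f : R -> \bar R) : measurable D ->
  mu.-integrable D f -> mu.-integrable (affine @^-1` D) (f \o affine).
Proof.
move=> mD /integrableP[mf fi]; apply/integrableP; split.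
  apply: (measurable_comp mD) => //; first by move=> _ [x Dx <-].
  exact: measurable_funS measurable_affine.
have := fi; rewrite ge0_integral_affine//; last exact: measurableT_comp.
rewrite !ltey; apply: contra_neq => ->.
by rewrite gt0_muley// lte_fin normr_gt0.
Qed.

Lemma integral_affine (D : set R) (f : R -> \bar R) : measurable D ->
  mu.-integrable D f ->
  (\int[mu]_(x in D) f x = `|k|%:E * \int[mu]_(x in affine @^-1` D) (f \o affine) x)%E.
Proof.
move=> mD fi; have fki := integrable_affine mD fi.
have mf := measurable_int mu fi.
have fposE : (\int[mu]_(x in D) f^\+ x =
    `|k|%:E * \int[mu]_(x in affine @^-1` D) (f \o affine)^\+ x)%E.
  by rewrite [in RHS]funepos_comp ge0_integral_affine//; exact: measurable_funepos.
have fnegE : (\int[mu]_(x in D) f^\- x =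
    `|k|%:E * \int[mu]_(x in affine @^-1` D) (f \o affine)^\- x)%E.
  by rewrite [in RHS]funeneg_comp ge0_integral_affine//; exact: measurable_funeneg.
rewrite integralE fposE fnegE [in RHS]integralE [RHS]muleBr//.
rewrite fin_num_adde_defr// (integrable_pos_fin_num _ fki)//.
exact: measurable_preimage_affine.
Qed.

End affine_change_of_variable.

Lemma integrable_setU (d : measure_display) (T : measurableType d) (R : realType)
    (mu : {measure set T -> \bar R}) (A B : set T) (g : T -> \bar R) :
  measurable A -> measurable B -> [disjoint A & B] ->
  mu.-integrable A g -> mu.-integrable B g -> mu.-integrable (A `|` B) g.
Proof.
move=> mA mB AB /integrableP[mfA fA] /integrableP[mfB fB].
have mf : measurable_fun (A `|` B) g by apply/measurable_funU.
apply/integrableP; split => //.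
rewrite ge0_integral_setU//; first exact: lte_add_pinfty.
exact: measurableT_comp.
Qed.

Section has_integral.
Context {R : realType}.
Implicit Types (D A B : set R) (f g : R -> R) (v w : R).
Notation mu := (@lebesgue_measure R).

Definition has_integral D f v : Prop :=
  mu.-integrable D (EFin \o f) /\ Rintegral mu D f = v.

Lemma eq_has_integral D f g v : measurable D -> (forall x, D x -> f x = g x) ->
  has_integral D f v -> has_integral D g v.
Proof.
move=> mD fg [fi <-]; have fg' : {in D, f =1 g} by move=> x /set_mem /fg.
split; last by apply: eq_Rintegral => x xD; rewrite fg'.
by apply: eq_integrable fi => // x /fg' /= ->.
Qed.

Lemma has_integralZl D f v k : measurable D ->
  has_integral D f v -> has_integral D (fun x => k * f x) (k * v).
Proof.
move=> mD [fi <-]; split; last by rewrite RintegralZl.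
exact: integrableZl fi.
Qed.

Lemma has_integralD D f g v w : measurable D ->
  has_integral D f v -> has_integral D g w -> has_integral D (fun x => f x + g x) (v + w).
Proof.
move=> mD [fi <-] [gi <-]; split; last by rewrite RintegralD.
exact: integrableD fi gi.
Qed.

Lemma has_integralU A B f v w : measurable A -> measurable B -> [disjoint A & B] ->
  has_integral A f v -> has_integral B f w -> has_integral (A `|` B) f (v + w).
Proof.
move=> mA mB AB [fA <-] [fB <-].
have fAB : mu.-integrable (A `|` B) (EFin \o f) by exact: integrable_setU.
by split => //; rewrite Rintegral_setU.
Qed.

Lemma has_integral0 D f : measurable D -> (forall x, D x -> f x = 0) ->
  has_integral D f 0.
Proof.
move=> mD f0; apply: (@eq_has_integral _ (cst 0)) => // [x /f0 ->//|].
split; first exact: integrable0.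
by rewrite Rintegral_cst// mul0r.
Qed.

Lemma has_integral_set1 a f : has_integral [set a] f 0.
Proof.
split; last exact: Rintegral_set1.
apply/integrableP; split; first exact: measurable_fun_set1.
by rewrite integral_set1 ltry.
Qed.

Lemma has_integral_widen A D f v : measurable A -> measurable D -> A `<=` D ->
  (forall x, D x -> ~ A x -> f x = 0) -> has_integral A f v -> has_integral D f v.
Proof.
move=> mA mD AD f0 fA; rewrite -(setDUK AD) -[v]addr0.
apply: has_integralU => //; first exact: measurableD.
  by apply/disj_setPS => x [Ax [_]].
by apply: has_integral0 => [|x [Dx /f0]]; [exact: measurableD | exact].
Qed.

Lemma has_integral_setU1 D a f v : measurable D ->
  has_integral D f v -> has_integral (a |` D) f v.
Proof.
move=> mD fD; have [Da|nDa] := pselect (D a); first by rewrite setUidr// => _ ->.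
rewrite -[v]add0r; apply: has_integralU => //; last exact: has_integral_set1.
by apply/disj_setPS => x /= [->].
Qed.

Lemma eq_has_integral_setD1 D a f g v : measurable D ->
  (forall x, D x -> x != a -> f x = g x) -> has_integral D f v -> has_integral D g v.
Proof.
move=> mD fg fD; have mDa : measurable (D `\ a) by exact: measurableD.
have fDa : has_integral (D `\ a) f (Rintegral mu (D `\ a) f).
  by split=> //; apply: integrableS fD.1.
have [Da|nDa] := pselect (D a); last first.
  apply: eq_has_integral fD => // x Dx; apply: fg => //.
  by apply: contra_notN nDa => /eqP <-.
have := has_integral_setU1 a mDa fDa; rewrite setD1K// => -[_ vE].
rewrite -fD.2 vE -[X in has_integral X](setD1K Da); apply: has_integral_setU1 => //.
by apply: eq_has_integral fDa => // x [Dx /eqP]; exact: fg.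
Qed.

Lemma has_integral_itv_cat (a b : itv_bound R) c f v w : c \in Interval a b ->
  has_integral [set` Interval a (BLeft c)] f v ->
  has_integral [set` Interval (BRight c) b] f w ->
  has_integral [set` Interval a b] f (v + w).
Proof.
move=> cab fv fw; rewrite -(@setD1K _ c [set` Interval a b])// set_itv_splitU//.
apply: has_integral_setU1; first exact: measurableU.
apply: has_integralU => //; apply/disj_setPS => x /= [].
rewrite !itv_boundlr !bnd_simp => /andP[_ xc] /andP[cx _].
by have := lt_trans cx xc; rewrite ltxx.
Qed.

Lemma has_integral_itvcc a b f v : a < b ->
  has_integral `]a, b[ f v -> has_integral `[a, b] f v.
Proof.
move=> ab fv; rewrite -(@setU1itv _ _ _ _ false) ?bnd_simp ?ltW//.
apply: has_integral_setU1 => //.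
rewrite -(@setUitv1 _ _ _ _ true) ?bnd_simp// setUC.
exact: has_integral_setU1.
Qed.

Lemma has_integral_affine D f v k c : k != 0 -> measurable D -> has_integral D f v ->
  has_integral [set x | D (k * x + c)] (fun x => f (k * x + c)) (`|k|^-1 * v).
Proof.
move=> k0 mD [fi <-]; have fki := integrable_affine c k0 mD fi; split=> //.
have Ifin := integrable_fin_num (measurable_preimage_affine k c mD) fki.
by rewrite /Rintegral (integral_affine c k0 mD fi) fineM//= mulKf// normr_eq0.
Qed.

Lemma has_integral_itv_shift c x y f v : has_integral `]x - c, y - c[ f v ->
  has_integral `]x, y[ (fun t => f (t - c)) v.
Proof.
move=> fv; have := has_integral_affine (- c) (oner_neq0 R) (measurable_itv _) fv.
rewrite normr1 invr1 mul1r (_ : mkset _ = `]x, y[%classic).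
  by apply: eq_has_integral => // t _; rewrite mul1r.
by apply/seteqP; split => t /=; rewrite !in_itv/= mul1r; lra.
Qed.

Lemma has_integral_itv_reflect c x y f v : has_integral `]c - y, c - x[ f v ->
  has_integral `]x, y[ (fun t => f (c - t)) v.
Proof.
move=> fv; have N1_neq0 : -1 != 0 :> R by rewrite oppr_eq0 oner_neq0.
have := has_integral_affine c N1_neq0 (measurable_itv _) fv.
rewrite normrN1 invr1 mul1r (_ : mkset _ = `]x, y[%classic).
  by apply: eq_has_integral => // t _; rewrite mulN1r addrC.
by apply/seteqP; split => t /=; rewrite !in_itv/= mulN1r; lra.
Qed.

Lemma ge0_has_integral D f v : measurable D -> measurable_fun D f ->
  (forall x, D x -> 0 <= f x) -> (\int[mu]_(x in D) (f x)%:E = v%:E)%E ->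
  has_integral D f v.
Proof.
move=> mD mf f0 fv; split; last by rewrite /Rintegral fv.
apply/integrableP; split; first exact/measurable_EFinP.
rewrite (_ : integral _ _ _ = v%:E) ?ltry// -fv.
by apply: eq_integral => x /set_mem /f0 fx /=; rewrite ger0_norm.
Qed.

End has_integral.

Section improper_FTC.
Context {R : realType}.
Implicit Types (f g F G : R -> R) (u v : R^nat) (a b r l L : R).
Notation mu := (@lebesgue_measure R).

Lemma continuous_within_itvcc f a b :
  (forall x, a <= x <= b -> {for x, continuous f}) -> {within `[a, b], continuous f}.
Proof.
move=> cf; apply: continuous_in_subspaceT => x /set_mem; rewrite /= in_itv/=.
exact: cf.
Qed.

Lemma is_derive_FTC2 f F a b : a < b ->
  (forall x, a <= x <= b -> is_derive x 1 F (f x)) ->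
  (forall x, a <= x <= b -> {for x, continuous f}) ->
  (\int[mu]_(x in `[a, b]) (f x)%:E = (F b - F a)%:E)%E.
Proof.
move=> ab Ff cf.
have cF x : a <= x <= b -> {for x, continuous F}.
  by move=> /Ff; exact: is_derive1_continuous.
rewrite (@continuous_FTC2 _ f F)// => [||x].
- exact: continuous_within_itvcc.
- split; [|apply: cvg_at_right_filter|apply: cvg_at_left_filter].
  + move=> x; rewrite in_itv/= => /andP[/ltW ax /ltW xb].
    by have [|? _] := Ff x; rewrite ?ax//; exact: ex_derive.
  + by apply: cF; rewrite lexx ltW.
  + by apply: cF; rewrite lexx ltW.
- rewrite in_itv/= => /andP[/ltW ax /ltW xb].
  by apply: is_derive1_derive1; apply: Ff; rewrite ax.
Qed.

Lemma ge0_FTC_bigcup (I : set R) f F u v l L :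
  nonincreasing_seq u -> nondecreasing_seq v -> (forall n, u n < v n) ->
  \bigcup_n `[u n, v n]%classic = I ->
  (forall x, I x -> [/\ is_derive x 1 F (f x), {for x, continuous f} & 0 <= f x]) ->
  F (u n) @[n --> \oo] --> l -> F (v n) @[n --> \oo] --> L ->
  has_integral I f (L - l).
Proof.
move=> du iv uv <- FfI Fl FL.
have Ff n x : u n <= x <= v n ->
    [/\ is_derive x 1 F (f x), {for x, continuous f} & 0 <= f x].
  by move=> xn; apply: FfI; exists n => //=; rewrite in_itv.
have mf n : measurable_fun `[u n, v n]%classic f.
  apply: subspace_continuous_measurable_fun => //.
  by apply: continuous_within_itvcc => x /Ff[].
apply: ge0_has_integral.
- exact: bigcup_measurable.
- by apply/measurable_fun_bigcup.
- by move=> x /FfI[].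
have int_cvg : (\int[mu]_(x in `[u n, v n]) (f x)%:E)%E @[n --> \oo] -->
    (\int[mu]_(x in \bigcup_n `[u n, v n]%classic) (f x)%:E)%E.
  apply: ge0_nondecreasing_set_cvg_integral => // [m n mn|n|n x].
  - by rewrite subsetEset; apply: subset_itv; rewrite bnd_simp; [exact: du|exact: iv].
  - by apply/measurable_EFinP; exact: mf.
  - by rewrite /= in_itv/= => /Ff[]; rewrite lee_fin.
have intE n : (\int[mu]_(x in `[u n, v n]) (f x)%:E = (F (v n) - F (u n))%:E)%E.
  by apply: is_derive_FTC2 => // x /Ff[].
apply: (cvg_unique _ int_cvg) => //; rewrite (funext intE).
by apply: cvg_EFin; [exact: nearW | exact: cvgB].
Qed.

Lemma bigcup_itvcc_oo a b u v : (forall n, a < u n) -> (forall n, v n < b) ->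
  u @ \oo --> a -> v @ \oo --> b ->
  \bigcup_n `[u n, v n]%classic = `]a, b[%classic.
Proof.
move=> au vb ua vb'; apply/seteqP; split => x /=.
  move=> [n _]; rewrite /= !in_itv/= => /andP[ux xv].
  by rewrite (lt_le_trans (au n) ux) (le_lt_trans xv (vb n)).
rewrite in_itv/= => /andP[ax xb].
have [n [ux xv]] : exists n, u n <= x /\ x <= v n.
  near \oo => n; exists n; split; near: n.
    exact: (cvgr_le a).
  exact: (cvgr_ge b).
by exists n => //=; rewrite in_itv/= ux.
Unshelve. all: by end_near. Qed.

Lemma bigcup_itvcc_oy a u v : (forall n, a < u n) ->
  u @ \oo --> a -> v n @[n --> \oo] --> +oo ->
  \bigcup_n `[u n, v n]%classic = `]a, +oo[%classic.
Proof.
move=> au ua vy; apply/seteqP; split => x /=.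
  move=> [n _]; rewrite /= !in_itv/= andbT => /andP[ux _].
  exact: lt_le_trans (au n) ux.
rewrite in_itv/= andbT => ax.
have [n [ux xv]] : exists n, u n <= x /\ x <= v n.
  near \oo => n; exists n; split; near: n.
    exact: (cvgr_le a).
  exact: (cvgryPge _).1.
by exists n => //=; rewrite in_itv/= ux.
Unshelve. all: by end_near. Qed.

Lemma ge0_FTC_oo f F a b l L : a < b ->
  (forall x, a < x < b ->
     [/\ is_derive x 1 F (f x), {for x, continuous f} & 0 <= f x]) ->
  F x @[x --> a^'+] --> l -> F x @[x --> b^'-] --> L ->
  has_integral `]a, b[ f (L - l).
Proof.
move=> ab Ff Fl FL; pose d n : R := (b - a) / 3 / n.+1%:R.
have d0 n : 0 < d n by rewrite !divr_gt0// subr_gt0.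
have dle m n : (m <= n)%N -> d n <= d m.
  by move=> mn; rewrite ler_pM2l ?divr_gt0 ?subr_gt0// lef_pV2 ?posrE// ler_nat.
have d_cvg0 : d n @[n --> \oo] --> 0.
  rewrite -[X in _ --> X](mulr0 ((b - a) / 3)).
  by apply: cvgM; [exact: cvg_cst|exact: cvg_harmonic].
have ua n : a < a + d n by rewrite ltrDl.
have vb n : b - d n < b by rewrite gtrBl.
have u_cvg : a + d n @[n --> \oo] --> a.
  by rewrite -[X in _ --> X]addr0; apply: cvgD => //; exact: cvg_cst.
have v_cvg : b - d n @[n --> \oo] --> b.
  by rewrite -[X in _ --> X]subr0; apply: cvgB => //; exact: cvg_cst.
apply: (@ge0_FTC_bigcup _ f F (fun n => a + d n) (fun n => b - d n)).
- by move=> m n mn; rewrite lerD2l dle.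
- by move=> m n mn; rewrite lerD2l lerN2 dle.
- by move=> n; have := dle 0%N n (leq0n n); rewrite [X in _ <= X]divr1; lra.
- exact: bigcup_itvcc_oo.
- by move=> x; rewrite /= in_itv/=; exact: Ff.
- by move/cvg_at_rightP : Fl; exact.
- by move/cvg_at_leftP : FL; exact.
Qed.

Lemma ge0_FTC_oy f F a l L :
  (forall x, a < x ->
     [/\ is_derive x 1 F (f x), {for x, continuous f} & 0 <= f x]) ->
  F x @[x --> a^'+] --> l -> F x @[x --> +oo] --> L ->
  has_integral `]a, +oo[ f (L - l).
Proof.
move=> Ff Fl FL.
have ua n : a < a + n.+1%:R^-1 by rewrite ltrDl.
have u_cvg : a + n.+1%:R^-1 @[n --> \oo] --> a.
  by rewrite -[X in _ --> X]addr0; apply: cvgD; [exact: cvg_cst|exact: cvg_harmonic].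
have v_cvg : a + n.+2%:R @[n --> \oo] --> +oo.
  apply/cvgryPge => r; near=> n; rewrite -lerBlDl (@le_trans _ _ n%:R)//.
    by near: n; exact: nbhs_infty_ger.
  by rewrite ler_nat 2?leqW.
apply: (@ge0_FTC_bigcup _ f F (fun n => a + n.+1%:R^-1) (fun n => a + n.+2%:R)).
- by move=> m n mn; rewrite lerD2l lef_pV2 ?posrE// ler_nat.
- by move=> m n mn; rewrite lerD2l ler_nat.
- by move=> n; rewrite ltrD2l (@le_lt_trans _ _ 1)// ?ltr1n// invf_le1// ler1n.
- exact: bigcup_itvcc_oy.
- by move=> x; rewrite /= in_itv/= andbT; exact: Ff.
- by move/cvg_at_rightP : Fl; exact.
- by move/cvg_pinftyP : FL; exact.
Unshelve. all: by end_near. Qed.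

Lemma ge0_FTC_oy_inv f g G r l L : 0 < r ->
  (forall t, 0 < t < r -> is_derive t 1 G (g t)) ->
  (forall y, r^-1 < y ->
     [/\ f y = g y^-1 / y ^+ 2, {for y, continuous f} & 0 <= f y]) ->
  G t @[t --> 0^'+] --> l -> G t @[t --> r^'-] --> L ->
  has_integral `]r^-1, +oo[ f (L - l).
Proof.
move=> r0 dG fg G0 Gr; have rV0 : 0 < r^-1 by rewrite invr_gt0.
have yVr y : r^-1 < y -> 0 < y^-1 < r.
  by move=> ry; have y0 := lt_trans rV0 ry; rewrite invr_gt0 y0 -[r]invrK ltf_pV2.
have -> : L - l = - l - - L by rewrite opprK addrC.
apply: (ge0_FTC_oy (F := fun y => - G y^-1)).
- move=> y ry; have y_neq0 := lt0r_neq0 (lt_trans rV0 ry).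
  have [fyE cf f0] := fg y ry; split=> //.
  have dV : is_derive y 1 (fun y => y^-1) (- 1 / y ^+ 2) by exact: (@is_derive1V _ id).
  rewrite fyE; apply: is_derive_eq (is_deriveN (is_derive1_chain (dG _ (yVr y ry)) dV)) _.
  by rewrite mulNr mulrN opprK div1r.
- apply: cvgN; apply: cvg_comp_at_left Gr.
    rewrite -[X in _ --> X]invrK; apply: cvgV; first by rewrite gt_eqF.
    by apply: cvg_at_right_filter; exact: cvg_id.
  near=> y; have /yVr/andP[] // : r^-1 < y.
  by near: y; exact: nbhs_right_gt.
- apply: cvgN; apply: cvg_comp_at_right G0.
    apply/(@gtr0_cvgV0 _ _ _ _ id); last exact: cvg_id.
    by near=> y; near: y; exact: (nbhs_pinfty_gt (num_real _)).
  by near=> y; rewrite invr_gt0; near: y; exact: (nbhs_pinfty_gt (num_real _)).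
Unshelve. all: by end_near. Qed.

End improper_FTC.

(** * The incomplete beta function and the cotangent *)

Section incomplete_beta.
Context {R : realType}.
Implicit Types (a x : R).

Definition ibeta_coef a : R^nat := fun n => (n%:R + a)^-1.

(* The incomplete beta function B(x; a, 0), i.e. the integral of
   t `^ (a - 1) / (1 - t) between 0 and x. *)
Definition ibeta a x : R := x `^ a * limn (pseries (ibeta_coef a) x).

Lemma is_cvg_ibeta_coef a x : 0 < a -> `|x| < 1 -> cvgn (pseries (ibeta_coef a) x).
Proof.
move=> a0 x1; apply: normed_cvg.
apply: (@series_le_cvg _ _ (geometric a^-1 `|x|)) => [n|n|n|] /=.
- exact: normr_ge0.
- by rewrite mulr_ge0 ?invr_ge0 ?exprn_ge0// ltW.
- have na0 : 0 < n%:R + a by rewrite ltr_wpDl.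
  rewrite normrM normrX ler_wpM2r ?exprn_ge0// gtr0_norm ?invr_gt0//.
  by rewrite lef_pV2 ?posrE// lerDr.
- by apply: is_cvg_geometric_series; rewrite normr_id.
Qed.

Lemma ibeta_coef_cvg_beyond a x : 0 < a -> `|x| < 1 ->
  exists2 K : R, `|x| < `|K| & cvgn (pseries (ibeta_coef a) K).
Proof.
move=> a0 x1; have x0 := normr_ge0 x; pose K : R := (1 + `|x|) / 2.
have KE : `|K| = K by rewrite ger0_norm// /K; lra.
exists K; first by rewrite KE /K; lra.
by apply: is_cvg_ibeta_coef => //; rewrite KE /K; lra.
Qed.

Lemma is_derive_ibeta_series a x : 0 < a -> `|x| < 1 ->
  is_derive x 1 (fun t => limn (pseries (ibeta_coef a) t))
    (limn (pseries (pseries_diffs (ibeta_coef a)) x)).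
Proof.
by move=> a0 /(ibeta_coef_cvg_beyond a0)[K xK cK]; exact: is_derive_pseries cK xK.
Qed.

Lemma ibeta_series_ode a x : 0 < a -> `|x| < 1 ->
  a * limn (pseries (ibeta_coef a) x) +
  x * limn (pseries (pseries_diffs (ibeta_coef a)) x) = (1 - x)^-1.
Proof.
move=> a0 x1; have [K xK cK] := ibeta_coef_cvg_beyond a0 x1.
have c1 := is_cvg_ibeta_coef a0 x1.
have c2 := pseries_diffs_equiv (is_cvg_pseries_diffs cK xK).
suff -> : (1 - x)^-1 = limn ((fun=> a) \* pseries (ibeta_coef a) x +
    (fun=> x) \* series (fun i => i%:R * ibeta_coef a i * x ^+ i.-1)).
  apply/esym/cvg_lim => //; apply: cvgD; first by apply: cvgM => //; exact: cvg_cst.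
  by apply: cvgM => //; exact: cvg_cst.
rewrite (_ : _ + _ = series (geometric 1 x)).
  by rewrite -[LHS]mul1r; apply/esym/cvg_lim => //; exact: cvg_geometric_series.
apply/funext => n; rewrite /pseries /series !fctE /= !mulr_sumr -big_split/=.
apply: eq_bigr => -[|i] _ /=.
  rewrite expr0 /ibeta_coef mul0r add0r mul0r mulr0 addr0.
  by rewrite !mulr1 divff// gt_eqF.
rewrite /ibeta_coef mul1r exprS.
have : i.+1%:R + a != 0 by rewrite gt_eqF// ltr_wpDl.
by move: i.+1%:R => k k0; field.
Qed.

Lemma is_derive_ibeta a x : 0 < a -> 0 < x < 1 ->
  is_derive x 1 (ibeta a) (x `^ (a - 1) / (1 - x)).
Proof.
move=> a0 /andP[x0 x1].
have nx : `|x| < 1 by rewrite gtr0_norm.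
apply: is_derive_eq.
  exact: is_derive1M (is_derive1_powR _ x0) (is_derive_ibeta_series a0 nx).
rewrite -(ibeta_series_ode a0 nx) mulrDr -(mulr_powRB1 (ltW x0) a0).
by ring.
Qed.

Lemma ibeta_cvg0 a : 0 < a -> ibeta a x @[x --> 0^'+] --> 0.
Proof.
move=> a0; rewrite -[X in _ --> X](mul0r (limn (pseries (ibeta_coef a) 0))).
apply: (@cvgM _ _ _ _ (fun x => x `^ a)); first exact: powR_cvg0.
apply: cvg_at_right_filter.
have n0 : `|0 : R| < 1 by rewrite normr0.
exact: is_derive1_continuous (is_derive_ibeta_series a0 n0).
Qed.

Lemma ibeta1E x : 0 < x < 1 -> ibeta 1 x = - ln (1 - x).
Proof.
have dln (t : R) : t < 1 -> is_derive t 1 (fun u => ln (1 - u)) (- (1 - t)^-1).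
  move=> t1; rewrite -mulrN1; apply: is_derive1_chain (is_derive1_onem t).
  by apply: is_derive1_ln; rewrite subr_gt0.
move: x; apply: (is_derive_unique (df := fun t => t `^ (1 - 1) / (1 - t)) (l := 0)).
- by move=> t t01; apply: is_derive_ibeta; rewrite ?ltr01.
- move=> t /andP[_ t1]; apply: is_derive_eq (is_deriveN (dln t t1)) _.
  by rewrite subrr powRr0 mul1r opprK.
- exact: ibeta_cvg0.
- rewrite -[X in _ --> X]oppr0 -[in X in _ --> X](@ln1 R) -[in X in _ --> X](subr0 1).
  by apply: cvgN; apply: cvg_at_right_filter; exact: is_derive1_continuous (dln 0 ltr01).
Qed.

Lemma ibetaS a x : 0 < a -> 0 < x < 1 -> ibeta a x = x `^ a / a + ibeta (a + 1) x.
Proof.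
move=> a0; have a1 : 0 < a + 1 by rewrite addr_gt0.
move: x; apply: (is_derive_unique (df := fun t => t `^ (a - 1) / (1 - t)) (l := 0)).
- by move=> x; exact: is_derive_ibeta.
- move=> x x01; have /andP[x0 x1] := x01.
  have dpow := is_derive1M (is_derive1_powR a x0) (is_derive_cst a^-1 x 1).
  apply: is_derive_eq (is_derive1D dpow (is_derive_ibeta a1 x01)) _.
  rewrite /= addrK -[x `^ a](mulr_powRB1 (ltW x0) a0).
  by field; rewrite subr_eq0 !gt_eqF.
- exact: ibeta_cvg0.
- rewrite -[X in _ --> X]addr0; apply: cvgD; last exact: ibeta_cvg0.
  rewrite -[X in _ --> X](mul0r a^-1); apply: cvgM; last exact: cvg_cst.
  exact: powR_cvg0.
Qed.

Lemma is_derive_ibeta_sqr a x : 0 < a -> 0 < x < 1 ->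
  is_derive x 1 (fun t => ibeta (a / 2) (t ^+ 2)) (2 * x `^ (a - 1) / (1 - x ^+ 2)).
Proof.
move=> a0 /andP[x0 x1].
have xx : 0 < x ^+ 2 < 1 by rewrite exprn_gt0//= expr_lt1// ltW.
apply: is_derive_eq.
  apply: (@is_derive1_chain _ (ibeta (a / 2))) (is_derive1_sqr x).
  by apply: is_derive_ibeta xx; rewrite divr_gt0.
have -> : (x ^+ 2) `^ (a / 2 - 1) = x `^ (a - 1) / x.
  rewrite -powR_mulrn ?(ltW x0)// -powRrM (_ : 2%:R * _ = (a - 1) - 1); last by lra.
  by rewrite powRB ?(gt_eqF x0) ?implybT// powRr1// ltW.
by field; rewrite subr_eq0 !gt_eqF//; case/andP: xx.
Qed.

Lemma ibeta_sqr_cvg0 a : 0 < a -> ibeta a (x ^+ 2) @[x --> 0^'+] --> 0.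
Proof. by move=> a0; apply: cvg_comp_sqr_at_right0; exact: ibeta_cvg0. Qed.

Lemma ibeta_duplication a x : 0 < a -> 0 < x < 1 ->
  ibeta (a / 2) (x ^+ 2) + ibeta ((a + 1) / 2) (x ^+ 2) = 2 * ibeta a x.
Proof.
move=> a0; have a1 : 0 < a + 1 by rewrite addr_gt0.
move: x; apply: (is_derive_unique (df := fun t => 2 * (t `^ (a - 1) / (1 - t))) (l := 0)).
- move=> x x01; have /andP[x0 x1] := x01.
  apply: is_derive_eq (is_derive1D (is_derive_ibeta_sqr a0 x01)
    (is_derive_ibeta_sqr a1 x01)) _.
  rewrite addrK -[x `^ a](mulr_powRB1 (ltW x0) a0).
  rewrite (_ : 1 - x ^+ 2 = (1 - x) * (1 + x)); last by ring.
  by field; rewrite subr_eq0 !gt_eqF// addr_gt0.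
- by move=> x x01; apply: is_derive1Zl; exact: is_derive_ibeta.
- by rewrite -[X in _ --> X]addr0; apply: cvgD; apply: ibeta_sqr_cvg0; rewrite divr_gt0.
- rewrite -[X in _ --> X](mulr0 2).
  by apply: cvgM; [exact: cvg_cst|exact: ibeta_cvg0].
Qed.

(* The integral of t `^ (a - 1) / (t + 1) between 0 and x, by
   1 / (t + 1) = 2 / (1 - t ^ 2) - 1 / (1 - t). *)
Definition ibeta_alt a x : R := ibeta (a / 2) (x ^+ 2) - ibeta a x.

Lemma is_derive_ibeta_alt a x : 0 < a -> 0 < x < 1 ->
  is_derive x 1 (ibeta_alt a) (x `^ (a - 1) / (x + 1)).
Proof.
move=> a0 x01; have /andP[x0 x1] := x01; apply: is_derive_eq.
  exact: is_derive1B (is_derive_ibeta_sqr a0 x01) (is_derive_ibeta a0 x01).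
rewrite (_ : 1 - x ^+ 2 = (1 - x) * (x + 1)); last by ring.
by field; rewrite subr_eq0 !gt_eqF// addr_gt0.
Qed.

Lemma ibeta_alt_cvg0 a : 0 < a -> ibeta_alt a x @[x --> 0^'+] --> 0.
Proof.
move=> a0; rewrite -[X in _ --> X]subr0; apply: cvgB; last exact: ibeta_cvg0.
by apply: ibeta_sqr_cvg0; rewrite divr_gt0.
Qed.

End incomplete_beta.

Section ibeta_exponent.
Context {R : realType}.
Implicit Types (a b x : R).

Lemma powRB_bounds a b x : 1 <= a -> a <= b -> 0 < x < 1 ->
  0 <= x `^ a - x `^ b <= (b - a) * (1 - x).
Proof.
move=> a1 ab /andP[x0 x1]; have x01 : 0 < x <= 1 by rewrite x0 ltW.
have d0 : 0 <= b - a by rewrite subr_ge0.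
rewrite subr_ge0 ger_powR//=.
have -> : x `^ b = x `^ a * x `^ (b - a).
  by rewrite -powRD ?(gt_eqF x0) ?implybT//; congr (_ `^ _); lra.
have ln_le : - ln x <= x^-1 - 1.
  rewrite -lnV ?posrE// -{1}[x^-1](subrK 1) addrC le_ln1Dx//.
  by rewrite ltrBrDr addrC subrr invr_gt0.
have ge_ln : 1 + (b - a) * ln x <= x `^ (b - a) by rewrite /powR gt_eqF// expR_ge1Dx.
rewrite -{1}[x `^ a]mulr1 -mulrBr (@le_trans _ _ (x * (1 - x `^ (b - a))))//.
  by rewrite ler_wpM2r ?ge1r_powR// subr_ge0 -(powRr0 x) ger_powR.
have -> : (b - a) * (1 - x) = x * ((b - a) * (x^-1 - 1)) by field; rewrite gt_eqF.
by rewrite ler_pM2l//; have := ler_wpM2l d0 ln_le; lra.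
Qed.

Lemma is_derive_ibetaB a b x : 0 < a -> 0 < b -> 0 < x < 1 ->
  is_derive x 1 (fun t => ibeta a t - ibeta b t)
    ((x `^ (a - 1) - x `^ (b - 1)) / (1 - x)).
Proof.
move=> a0 b0 x01; rewrite mulrBl.
by apply: is_derive1B; exact: is_derive_ibeta.
Qed.

Lemma ibetaB_cvg0 a b : 0 < a -> 0 < b ->
  (ibeta a x - ibeta b x) @[x --> 0^'+] --> 0.
Proof.
by move=> a0 b0; rewrite -[X in _ --> X]subr0; apply: cvgB; exact: ibeta_cvg0.
Qed.

Section exponents_ge2.
Variables a b : R.
Hypotheses (a2 : 2 <= a) (ab : a <= b).

Let a0 : 0 < a. Proof. by move: a2; lra. Qed.
Let b0 : 0 < b. Proof. exact: lt_le_trans ab. Qed.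

Lemma ibetaB_derive_bounds x : 0 < x < 1 ->
  0 <= (x `^ (a - 1) - x `^ (b - 1)) / (1 - x) <= b - a.
Proof.
move=> x01; have /andP[_ x1] := x01; have y0 : 0 < 1 - x by rewrite subr_gt0.
have a1 : 1 <= a - 1 by move: a2; lra.
have ab1 : a - 1 <= b - 1 by rewrite lerD2r.
have /andP[powRB_ge0 powRB_le] := powRB_bounds a1 ab1 x01.
rewrite divr_ge0 ?(ltW y0)//= ler_pdivrMr// (le_trans powRB_le)//.
by rewrite ler_wpM2r ?(ltW y0)//; lra.
Qed.

Lemma ibetaB_homo : {in `]0, 1[ &, {homo (fun x => ibeta a x - ibeta b x) : x y / x <= y}}.
Proof.
apply: is_derive_ge0_homo => x x01; first exact: is_derive_ibetaB.
by case/andP: (ibetaB_derive_bounds x01).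
Qed.

Lemma ibetaB_bounds x : 0 < x < 1 -> 0 <= ibeta a x - ibeta b x <= (b - a) * x.
Proof.
have dB (t : R) : 0 < t < 1 -> is_derive t 1 (fun t => ibeta a t - ibeta b t)
    ((t `^ (a - 1) - t `^ (b - 1)) / (1 - t)) by exact: is_derive_ibetaB.
move=> x01; apply/andP; split; move: x x01.
  apply: (is_derive_le (f := cst 0) (df := cst 0) _ dB) => [t t01||].
  - by case/andP: (ibetaB_derive_bounds t01).
  - exact: cvg_cst.
  - exact: ibetaB_cvg0.
apply: (is_derive_le (g := fun t => (b - a) * t) (dg := fun=> (b - a) * 1) dB) => [t t01||].
- by rewrite mulr1; case/andP: (ibetaB_derive_bounds t01).
- exact: ibetaB_cvg0.
- rewrite -[X in _ --> X](mulr0 (b - a)); apply: cvgM; first exact: cvg_cst.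
  by apply: cvg_at_right_filter; exact: cvg_id.
Qed.

End exponents_ge2.

End ibeta_exponent.

Section ibeta_limit.
Context {R : realType}.
Implicit Types (a b x l : R).

Lemma powR_cvg1 a : (x : R) `^ a @[x --> (1 : R)^'-] --> (1 : R).
Proof.
rewrite -[X in _ --> X](_ : 1 `^ a = 1); last by rewrite powR1.
apply: cvg_at_left_filter.
exact: is_derive1_continuous (is_derive1_powR a (@ltr01 R)).
Qed.

Lemma ln1D_cvg : ln (1 + x) @[x --> (1 : R)^'-] --> ln (2 : R).
Proof.
apply: (@cvg_at_left_filter R _ (fun x : R => ln (1 + x)) 1).
apply: (@continuous_comp _ _ _ (fun x : R => 1 + x)).
  by apply: continuousD; [exact: cst_continuous | exact: cvg_id].
exact: continuous_ln.
Qed.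

Definition ibeta_reg a x : R := ibeta a x + ln (1 - x).

(* Equal to minus (the digamma function at [a] plus Euler's constant). *)
Definition ibeta_lim1 a : R := lim (ibeta_reg a x @[x --> (1 : R)^'-]).

Lemma ibeta_reg_cvgS a l : 0 < a -> ibeta_reg (a + 1) x @[x --> 1^'-] --> l ->
  ibeta_reg a x @[x --> 1^'-] --> a^-1 + l.
Proof.
move=> a0 cvl; apply: (eq_cvg_at_left ltr01
    (f := fun x => x `^ a / a + ibeta_reg (a + 1) x)).
  by move=> x x01; rewrite /ibeta_reg addrA -ibetaS.
apply: cvgD cvl; rewrite -[X in _ --> X]mul1r.
by apply: cvgM; [exact: powR_cvg1|exact: cvg_cst].
Qed.

Lemma is_cvg_ibeta2B a : 2 <= a -> cvg ((ibeta 2 x - ibeta a x) @[x --> (1 : R)^'-]).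
Proof.
move=> a2; apply: nondecreasing_at_left_is_cvgr; apply: (near_at_left_oo ltr01) => x x01.
  have /andP[x0 _] := x01.
  move=> y z; rewrite !in_itv/= => /andP[xy y1] /andP[xz z1].
  by apply: ibetaB_homo; rewrite // in_itv/= ?y1 ?z1 (lt_trans x0).
exists (a - 2) => _ [y /= + <-]; rewrite in_itv/= => /andP[xy y1].
have y0 : 0 < y by case/andP: x01 => x0 _; exact: lt_trans xy.
have y01 : 0 < y < 1 by rewrite y0.
have /andP[_ /le_trans] := ibetaB_bounds (lexx 2) a2 y01; apply.
by rewrite ler_piMr ?subr_ge0// ltW.
Qed.

Lemma is_cvg_ibeta_reg_ge2 a : 2 <= a -> cvg (ibeta_reg a x @[x --> (1 : R)^'-]).
Proof.
move=> a2; have /cvg_ex[/= l Bl] := is_cvg_ibeta2B a2.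
apply/cvg_ex; exists (- 1 - l).
apply: (eq_cvg_at_left ltr01 (f := fun x => - x - (ibeta 2 x - ibeta a x))).
  move=> x x01; have := ibeta1E x01; have := ibetaS (@ltr01 R) x01.
  by rewrite /ibeta_reg divr1 powRr1 -?[1 + 1]/(2%:R); [lra|case/andP: x01 => /ltW].
apply: cvgB Bl; apply: cvgN.
by apply: cvg_at_left_filter; exact: cvg_id.
Qed.

Lemma ibeta_reg_cvg a : 0 < a -> ibeta_reg a x @[x --> (1 : R)^'-] --> ibeta_lim1 a.
Proof.
move=> a0; suff [l cvl] : exists l, ibeta_reg a x @[x --> (1 : R)^'-] --> l.
  by rewrite /ibeta_lim1 (cvg_lim _ cvl).
have a2 : 2 <= a + 1 + 1 by lra.
have /cvg_ex[/= l cvl] := is_cvg_ibeta_reg_ge2 a2.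
exists (a^-1 + ((a + 1)^-1 + l)).
by apply: ibeta_reg_cvgS => //; apply: ibeta_reg_cvgS => //; rewrite addr_gt0.
Qed.

Lemma ibeta_lim1S a : 0 < a -> ibeta_lim1 a = a^-1 + ibeta_lim1 (a + 1).
Proof.
move=> a0; apply: (cvg_unique _ (ibeta_reg_cvg a0)) => //.
by apply: ibeta_reg_cvgS => //; apply: ibeta_reg_cvg; rewrite addr_gt0.
Qed.

Lemma ibeta_lim1B_bounds a b : 2 <= a -> a <= b ->
  0 <= ibeta_lim1 a - ibeta_lim1 b <= b - a.
Proof.
move=> a2 ab.
have Bcvg : (ibeta_reg a x - ibeta_reg b x) @[x --> (1 : R)^'-] -->
    ibeta_lim1 a - ibeta_lim1 b.
  by apply: cvgB; apply: ibeta_reg_cvg; lra.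
apply/andP; split; [apply: (cvgr_to_ge Bcvg)|apply: (cvgr_to_le Bcvg)];
  apply: (near_at_left_oo ltr01) => x x01; have := ibetaB_bounds a2 ab x01.
  by rewrite /ibeta_reg; lra.
have : (b - a) * x <= b - a by case/andP: x01 => _ /ltW; apply: ler_piMr; rewrite subr_ge0.
by rewrite /ibeta_reg; lra.
Qed.

Lemma ibeta_lim1_lipschitz a b : 1 <= a -> 1 <= b ->
  `|ibeta_lim1 a - ibeta_lim1 b| <= 2 * `|a - b|.
Proof.
wlog ab : a b / a <= b => [hwlog a1 b1|a1 b1].
  have [/hwlog|/ltW/hwlog] := leP a b; first exact.
  by rewrite distrC [`|a - b|]distrC; exact.
have a0 : 0 < a by lra.
have b0 : 0 < b by lra.
have a2 : 2 <= a + 1 by lra.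
have /andP[limB_ge0 limB_le] := ibeta_lim1B_bounds a2 (lerD ab (lexx 1)).
have inv_le : 0 <= a^-1 - b^-1 <= b - a.
  rewrite subr_ge0 lef_pV2// ab/=.
  have -> : a^-1 - b^-1 = (b - a) / (a * b) by field; rewrite !gt_eqF.
  rewrite ler_piMr ?subr_ge0// invf_le1 ?mulr_gt0//.
  by rewrite mulr_ege1.
by rewrite (ibeta_lim1S a0) (ibeta_lim1S b0) [`|a - b|]distrC !ger0_norm ?subr_ge0//; lra.
Qed.

Lemma ibeta_reg_sqr_cvg a : 0 < a ->
  ibeta_reg a (x ^+ 2) @[x --> (1 : R)^'-] --> ibeta_lim1 a.
Proof. by move=> a0; apply: cvg_comp_sqr_at_left1; exact: ibeta_reg_cvg. Qed.

Lemma ln1Bsqr x : 0 < x < 1 -> ln (1 - x ^+ 2) = ln (1 - x) + ln (1 + x).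
Proof.
move=> /andP[x0 x1]; rewrite (_ : 1 - x ^+ 2 = (1 - x) * (1 + x)); last by ring.
by rewrite lnM// posrE ?subr_gt0 ?addr_gt0.
Qed.

Lemma ibeta_lim1_duplication a : 0 < a ->
  ibeta_lim1 (a / 2) + ibeta_lim1 ((a + 1) / 2) = 2 * ibeta_lim1 a + 2 * ln 2.
Proof.
move=> a0; have a1 : 0 < a + 1 by rewrite addr_gt0.
have sum_cvg : (ibeta_reg (a / 2) (x ^+ 2) + ibeta_reg ((a + 1) / 2) (x ^+ 2))
    @[x --> (1 : R)^'-] --> ibeta_lim1 (a / 2) + ibeta_lim1 ((a + 1) / 2).
  by apply: cvgD; apply: ibeta_reg_sqr_cvg; rewrite divr_gt0.
apply: (cvg_unique _ sum_cvg) => //.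
apply: (eq_cvg_at_left ltr01 (f := fun x => 2 * ibeta_reg a x + 2 * ln (1 + x))).
  by move=> x x01; have := ibeta_duplication a0 x01; rewrite /ibeta_reg ln1Bsqr//; lra.
apply: cvgD; (apply: cvgM; first exact: cvg_cst); first exact: ibeta_reg_cvg.
exact: ln1D_cvg.
Qed.

Lemma ibeta_alt_cvg a : 0 < a ->
  ibeta_alt a x @[x --> (1 : R)^'-] --> ibeta_lim1 (a / 2) - ibeta_lim1 a - ln 2.
Proof.
move=> a0; apply: (eq_cvg_at_left ltr01
    (f := fun x => ibeta_reg (a / 2) (x ^+ 2) - ibeta_reg a x - ln (1 + x))).
  by move=> x x01; rewrite /ibeta_reg /ibeta_alt ln1Bsqr//; lra.
apply: cvgB ln1D_cvg; apply: cvgB; last exact: ibeta_reg_cvg.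
by apply: ibeta_reg_sqr_cvg; rewrite divr_gt0.
Qed.

End ibeta_limit.

Section cotangent.
Context {R : realType}.
Implicit Types (x y : R).

Definition cot x : R := cos x / sin x.

Lemma cot_pihalf : cot (pi / 2) = 0.
Proof. by rewrite /cot cos_pihalf mul0r. Qed.

Lemma cotDpihalf x : cot (x + pi / 2) = - tan x.
Proof. by rewrite /cot cosDpihalf sinDpihalf mulNr. Qed.

Lemma cotB_tan x : sin x != 0 -> cos x != 0 -> cot x - tan x = 2 * cot (x *+ 2).
Proof.
move=> s0 c0; rewrite /cot /tan sin_mulr2n cos_mulr2n.
rewrite (_ : _ - 1 = cos x ^+ 2 - sin x ^+ 2); last by rewrite cos2sin2 -mulr_natr; lra.
by rewrite -mulr_natr; field; rewrite s0 c0.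
Qed.

Lemma invr_sin_mulr2n x : sin x != 0 -> cos x != 0 ->
  (sin (x *+ 2))^-1 = cot x - cot (x *+ 2).
Proof.
move=> s0 c0; rewrite /cot sin_mulr2n cos_mulr2n.
by rewrite -[_ ^+ 2 *+ 2]mulr_natr -[(_ * _) *+ 2]mulr_natr; field; rewrite s0 c0.
Qed.

Lemma is_derive_cot x : sin x != 0 -> is_derive x 1 cot (- (sin x ^- 2)).
Proof.
move=> s0; have dV := is_derive1V s0 (is_derive_sin x).
apply: is_derive_eq (is_derive1M (is_derive_cos x) dV) _.
by rewrite -[X in _ = - X]mul1r -(cos2Dsin2 x); field; exact: s0.
Qed.

Lemma mul_cos_le_sin_le y : 0 < y <= pi / 2 -> y * cos y <= sin y <= y.
Proof.
move=> /andP[y0 ypi]; have p0 := @pi_gt0 R.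
have [c] := @MVT R sin cos 0 y y0 (fun x _ => is_derive_sin x)
  (continuous_subspaceT (@continuous_sin R)).
rewrite in_itv/= sin0 !subr0 => /andP[c0 cy] ->.
have : cos y < cos c by rewrite ltr_cos// in_itv/= ?ltW//=; lra.
by have := cos_le1 c; nra.
Qed.

Lemma invr_sqr_sin_bounds y : 0 < y <= pi / 2 ->
  y ^- 2 <= sin y ^- 2 <= y ^- 2 + 1.
Proof.
move=> /andP[y0 ypi]; have p0 := @pi_gt0 R.
have /andP[yc_le le_y] := @mul_cos_le_sin_le y (introT andP (conj y0 ypi)).
have s0 : 0 < sin y by apply: sin_gt0_pi; rewrite y0; lra.
have c0 : 0 <= cos y by apply: cos_ge0_pihalf; rewrite ypi andbT; lra.
have yy : 0 < y ^+ 2 by rewrite exprn_gt0.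
have ss : 0 < sin y ^+ 2 by rewrite exprn_gt0.
have sqr_le : sin y ^+ 2 <= y ^+ 2 by rewrite lerXn2r// nnegrE ltW.
have ge_sqr : y ^+ 2 * cos y ^+ 2 <= sin y ^+ 2.
  by rewrite -exprMn lerXn2r// nnegrE ?mulr_ge0// ltW.
rewrite lef_pV2//= sqr_le/=.
have -> : y ^- 2 + 1 = (1 + y ^+ 2) / y ^+ 2 by field; rewrite gt_eqF.
rewrite ler_pdivlMr// ler_pdivrMl//.
by move: ge_sqr; rewrite cos2sin2; lra.
Qed.

Lemma sin_pi_gt0 x : 0 < x < 1 -> 0 < sin (pi * x).
Proof.
move=> /andP[x0 x1]; have p0 := @pi_gt0 R.
by apply: sin_gt0_pi; rewrite mulr_gt0//= gtr_pMr.
Qed.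

Let sin_cos_pi_half_neq0 x : 0 < x < 1 ->
  sin (pi * (x / 2)) != 0 /\ cos (pi * (x / 2)) != 0.
Proof.
move=> x01; have p0 := @pi_gt0 R; split; apply: lt0r_neq0.
  by apply: sin_pi_gt0; lra.
by apply: cos_gt0_pihalf; nra.
Qed.

Let mulr2n_pi_half x : (pi * (x / 2)) *+ 2 = pi * x.
Proof. by rewrite mulr2n; lra. Qed.

Lemma cot_pi_duplication x : 0 < x < 1 ->
  cot (pi * (x / 2)) + cot (pi * ((x + 1) / 2)) = 2 * cot (pi * x).
Proof.
move=> /sin_cos_pi_half_neq0[s0 c0]; rewrite -[X in _ = 2 * cot X]mulr2n_pi_half.
rewrite -cotB_tan// (_ : pi * ((x + 1) / 2) = pi * (x / 2) + pi / 2); last by lra.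
by rewrite cotDpihalf.
Qed.

Lemma invr_sin_pi x : 0 < x < 1 ->
  (sin (pi * x))^-1 = cot (pi * (x / 2)) - cot (pi * x).
Proof.
by move=> /sin_cos_pi_half_neq0[s0 c0]; rewrite -[pi * x]mulr2n_pi_half invr_sin_mulr2n.
Qed.

Definition cot_reg x : R := x^-1 - (1 - x)^-1 - pi * cot (pi * x).

Lemma is_derive_cot_reg x : 0 < x < 1 -> is_derive x 1 cot_reg
  (pi ^+ 2 * sin (pi * x) ^- 2 - x ^- 2 - (1 - x) ^- 2).
Proof.
move=> x01; have /andP[x0 x1] := x01; have s0 := lt0r_neq0 (sin_pi_gt0 x01).
have dV : is_derive x 1 (fun t => t^-1) (- 1 / x ^+ 2).
  by apply: (@is_derive1V _ id); rewrite ?gt_eqF.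
have d1BV : is_derive x 1 (fun t => (1 - t)^-1) (- - 1 / (1 - x) ^+ 2).
  by apply: is_derive1V (is_derive1_onem x); rewrite gt_eqF// subr_gt0.
have dcot : is_derive x 1 (fun t => cot (pi * t)) (- (sin (pi * x) ^- 2) * (pi * 1)).
  exact: is_derive1_chain (is_derive_cot s0) (is_derive1Zl pi (is_derive_id x 1)).
apply: is_derive_eq (is_derive1B (is_derive1B dV d1BV) (is_derive1Zl pi dcot)) _.
by rewrite !mulN1r opprK mul1r; ring.
Qed.

Lemma cot_reg_derive_bound x : 0 < x < 1 ->
  `|pi ^+ 2 * sin (pi * x) ^- 2 - x ^- 2 - (1 - x) ^- 2| <= pi ^+ 2 + 4.
Proof.
wlog x2 : x / x <= 1 / 2 => [hwlog x01|/andP[x0 x1]].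
  have [|x2] := leP x (1 / 2); first by move=> ?; exact: hwlog.
  have := hwlog (1 - x); rewrite subKr => hwlog1x.
  have -> : sin (pi * x) = sin (pi * (1 - x)).
    by rewrite mulrBr mulr1 sinB sinpi cospi mul0r mulN1r opprK add0r.
  by rewrite addrAC; apply: hwlog1x; lra.
have p0 := @pi_gt0 R.
have px : 0 < pi * x <= pi / 2 by rewrite mulr_gt0//= ler_pM2l//; lra.
have := invr_sqr_sin_bounds px; rewrite -![_ ^- 2 in X in X -> _]/(_^-1).
have p2 : 0 < (pi : R) ^+ 2 by rewrite exprn_gt0.
have -> : (pi * x) ^- 2 = (pi ^+ 2)^-1 * x ^- 2 by rewrite exprMn invfM.
move=> /andP[]; rewrite ler_pdivrMl// => ge_inv.
rewrite -(ler_pM2l p2) mulrDr mulVKf ?gt_eqF// => le_inv.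
have : 0 <= (1 - x) ^- 2 <= 4.
  rewrite invr_ge0 sqr_ge0/= -[4]invrK lef_pV2 ?posrE ?exprn_gt0 ?invr_gt0//; last by lra.
  by rewrite expr2; nra.
by move=> /andP[? ?]; rewrite ler_norml; apply/andP; split; lra.
Qed.

Lemma cot_reg_lipschitz x y : 0 < x < 1 -> 0 < y < 1 ->
  `|cot_reg x - cot_reg y| <= (pi ^+ 2 + 4) * `|x - y|.
Proof. exact: (is_derive_lipschitz is_derive_cot_reg cot_reg_derive_bound). Qed.

(* Herglotz's trick in Lipschitz form: the functional equation halves any
   Lipschitz constant, so no continuity at the end points is needed. *)
Lemma herglotz_trick (h : R -> R) (L : R) :
  (forall x y, 0 < x < 1 -> 0 < y < 1 -> `|h x - h y| <= L * `|x - y|) ->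
  (forall x, 0 < x < 1 -> h (x / 2) + h ((x + 1) / 2) = 2 * h x) ->
  forall x y, 0 < x < 1 -> 0 < y < 1 -> h x = h y.
Proof.
move=> hL h2 x y x01 y01; apply/eqP; rewrite -subr_eq0 -normr_le0.
have halve M : (forall x y, 0 < x < 1 -> 0 < y < 1 -> `|h x - h y| <= M * `|x - y|) ->
    forall x y, 0 < x < 1 -> 0 < y < 1 -> `|h x - h y| <= M / 2 * `|x - y|.
  move=> hM {x01 y01}x {}y x01 y01.
  have hx : h x = (h (x / 2) + h ((x + 1) / 2)) / 2 by rewrite h2//; lra.
  have hy : h y = (h (y / 2) + h ((y + 1) / 2)) / 2 by rewrite h2//; lra.
  have half_norm : `|(x - y) / 2| = `|x - y| / 2 by rewrite normrM [`|2^-1|]gtr0_norm.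
  have lo : `|h (x / 2) - h (y / 2)| <= M * (`|x - y| / 2).
    by rewrite -half_norm mulrBl; apply: hM; lra.
  have hi : `|h ((x + 1) / 2) - h ((y + 1) / 2)| <= M * (`|x - y| / 2).
    rewrite -half_norm (_ : (x - y) / 2 = (x + 1) / 2 - (y + 1) / 2); last by ring.
    by apply: hM; lra.
  rewrite hx hy; move: lo hi; rewrite !ler_norml.
  by move=> /andP[? ?] /andP[? ?]; apply/andP; split; lra.
have hn n : `|h x - h y| <= geometric (L * `|x - y|) 2^-1 n.
  rewrite /= mulrAC; elim: n x y x01 y01 => [|n IHn] {}x {}y x01 y01.
    by rewrite expr0 mulr1 hL.
  by rewrite exprSr mulrA; exact: halve IHn _ _ _ _.
have geo0 : geometric (L * `|x - y|) 2^-1 n @[n --> \oo] --> 0.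
  by apply: cvg_geometric; rewrite gtr0_norm// invf_lt1// ltr1n.
by apply: (cvgr_to_ge geo0); exact: nearW.
Qed.

Definition cot_defect x : R := ibeta_lim1 x - ibeta_lim1 (1 - x) - pi * cot (pi * x).

Lemma cot_defectE x : 0 < x < 1 ->
  cot_defect x = cot_reg x + (ibeta_lim1 (x + 1) - ibeta_lim1 (1 - x + 1)).
Proof.
move=> /andP[x0 x1]; rewrite /cot_defect /cot_reg (ibeta_lim1S x0).
by rewrite (@ibeta_lim1S R (1 - x)) ?subr_gt0//; ring.
Qed.

Lemma cot_defect_lipschitz x y : 0 < x < 1 -> 0 < y < 1 ->
  `|cot_defect x - cot_defect y| <= (pi ^+ 2 + 8) * `|x - y|.
Proof.
move=> x01 y01; rewrite !cot_defectE//.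
have /andP[x0 x1] := x01; have /andP[y0 y1] := y01.
have reg_le := cot_reg_lipschitz x01 y01.
have lo_le : `|ibeta_lim1 (x + 1) - ibeta_lim1 (y + 1)| <= 2 * `|x - y|.
  have := @ibeta_lim1_lipschitz R (x + 1) (y + 1).
  by rewrite (_ : x + 1 - _ = x - y); [apply; lra|ring].
have hi_le : `|ibeta_lim1 (1 - y + 1) - ibeta_lim1 (1 - x + 1)| <= 2 * `|x - y|.
  have := @ibeta_lim1_lipschitz R (1 - y + 1) (1 - x + 1).
  by rewrite (_ : _ + 1 - _ = x - y); [apply; lra|ring].
move: reg_le lo_le hi_le; move: (cot_reg x) (cot_reg y) => cx cy.
move: (ibeta_lim1 _) (ibeta_lim1 _) (ibeta_lim1 _) (ibeta_lim1 _) => u u' v v'.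
move: `|x - y| (pi ^+ 2) => d p; rewrite !ler_norml.
by move=> /andP[? ?] /andP[? ?] /andP[? ?]; apply/andP; split; lra.
Qed.

Lemma cot_defect_duplication x : 0 < x < 1 ->
  cot_defect (x / 2) + cot_defect ((x + 1) / 2) = 2 * cot_defect x.
Proof.
move=> x01; have /andP[x0 x1] := x01.
have cot_dup : pi * cot (pi * (x / 2)) + pi * cot (pi * ((x + 1) / 2)) =
    2 * (pi * cot (pi * x)) by rewrite -mulrDr cot_pi_duplication// mulrCA.
rewrite /cot_defect; have := ibeta_lim1_duplication x0.
have := @ibeta_lim1_duplication R (1 - x); rewrite subr_gt0 => /(_ x1).
rewrite (_ : (1 - x + 1) / 2 = 1 - x / 2); last by lra.
rewrite (_ : (1 - x) / 2 = 1 - (x + 1) / 2); last by lra.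
by lra.
Qed.

Lemma ibeta_lim1_reflection x : 0 < x < 1 ->
  ibeta_lim1 x - ibeta_lim1 (1 - x) = pi * cot (pi * x).
Proof.
move=> x01; apply/eqP; rewrite -subr_eq0; apply/eqP.
have half01 : 0 < (1 / 2 : R) < 1 by lra.
rewrite -[LHS]/(cot_defect x).
rewrite (herglotz_trick cot_defect_lipschitz cot_defect_duplication x01 half01).
rewrite /cot_defect div1r cot_pihalf mulr0 subr0.
by rewrite (_ : 1 - 2^-1 = 2^-1) ?subrr//; lra.
Qed.

Lemma ibeta_lim1_cosecant x : 0 < x < 1 ->
  ibeta_lim1 (x / 2) - ibeta_lim1 x - ln 2 +
  (ibeta_lim1 ((1 - x) / 2) - ibeta_lim1 (1 - x) - ln 2) = pi / sin (pi * x).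
Proof.
move=> x01; have /andP[x0 x1] := x01.
have half01 : 0 < x / 2 < 1 by lra.
rewrite (invr_sin_pi x01) mulrBr.
rewrite -(ibeta_lim1_reflection x01) -(ibeta_lim1_reflection half01).
have := @ibeta_lim1_duplication R (1 - x); rewrite subr_gt0 => /(_ x1).
rewrite (_ : (1 - x + 1) / 2 = 1 - x / 2); last by lra.
by lra.
Qed.

End cotangent.

(** * Hilbert transforms *)

Section hilbert_transform.
Context {R : realType}.
Implicit Types (f : R -> R) (x v k c p s eps : R).
Notation truncation x eps := [set y : R | eps < `|x - y|].

Lemma measurable_truncation x eps : measurable (truncation x eps).
Proof.
rewrite (_ : mkset _ = `]-oo, x - eps[%classic `|` `]x + eps, +oo[%classic).
  exact: measurableU.
apply/seteqP; split => y /=; rewrite !in_itv/= andbT lter_normr.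
  by move=> /orP[?|?]; [left|right]; lra.
by move=> [?|?]; apply/orP; [left|right]; lra.
Qed.

Lemma has_integral_is_hilbert f x v (I : R -> R) e : 0 < e ->
  (forall eps, 0 < eps < e ->
    has_integral (truncation x eps) (fun y => f y / (x - y)) (I eps)) ->
  I eps @[eps --> 0^'+] --> pi * v -> is_hilbert f x v.
Proof.
move=> e0 fI Icvg; split => [eps eps0|].
  have d0e : 0 < Num.min eps (e / 2) < e.
    by rewrite lt_min eps0 divr_gt0//= gt_min; apply/orP; right; lra.
  apply: integrableS (fI _ d0e).1; try exact: measurable_truncation.
  by move=> y /=; apply: le_lt_trans; rewrite ge_min lexx.
rewrite -[v](mulKf (lt0r_neq0 (@pi_gt0 R))).
apply: (eq_cvg_at_right e0 (f := fun eps => pi^-1 * I eps)).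
  by move=> eps /fI[_ <-].
by apply: cvgM; [exact: cvg_cst|].
Qed.

Lemma is_hilbert_has_integral f x v eps : is_hilbert f x v -> 0 < eps ->
  has_integral (truncation x eps) (fun y => f y / (x - y))
    (pi * hilbert_trunc f x eps).
Proof.
move=> [fi _] eps0; split; first exact: fi.
by rewrite /hilbert_trunc mulVKf// gt_eqF// pi_gt0.
Qed.

Lemma is_hilbertE f x v : is_hilbert f x v -> hilbert f x = v.
Proof. by move=> [_ cvgv]; exact: cvg_lim cvgv. Qed.

Lemma is_hilbertZ f x v k : is_hilbert f x v -> is_hilbert (fun y => k * f y) x (k * v).
Proof.
move=> fv; apply: (@has_integral_is_hilbert _ _ _
  (fun eps => k * (pi * hilbert_trunc f x eps)) 1) => // [eps /andP[eps0 _]|].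
  apply: eq_has_integral (has_integralZl k _ (is_hilbert_has_integral fv eps0)).
  - exact: measurable_truncation.
  - by move=> y _; rewrite mulrA.
  - exact: measurable_truncation.
rewrite [pi * _]mulrCA; apply: cvgM; first exact: cvg_cst.
by apply: cvgM; [exact: cvg_cst|case: fv].
Qed.

Lemma is_hilbert_affine f x v k c : 0 < k ->
  is_hilbert f (k * x + c) v -> is_hilbert (fun y => f (k * y + c)) x v.
Proof.
move=> k0 fv; have k_neq0 := lt0r_neq0 k0.
have subE y : k * x + c - (k * y + c) = k * (x - y) by ring.
apply: (@has_integral_is_hilbert _ _ _
  (fun eps => pi * hilbert_trunc f (k * x + c) (k * eps)) 1) => // [eps /andP[eps0 _]|].
  have keps0 : 0 < k * eps by rewrite mulr_gt0.
  have := has_integral_affine c k_neq0 (measurable_truncation _ _)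
    (is_hilbert_has_integral fv keps0).
  rewrite (_ : [set z | _ (k * z + c)] = truncation x eps); last first.
    by apply/seteqP; split => y /=; rewrite subE normrM gtr0_norm// ltr_pM2l.
  move=> /(has_integralZl k (measurable_truncation _ _)).
  rewrite gtr0_norm// mulVKf//; apply: eq_has_integral.
    exact: measurable_truncation.
  move=> y /= /(lt_trans eps0); rewrite normr_gt0 => xy0; rewrite subE.
  by field; rewrite xy0.
apply: cvgM; first exact: cvg_cst.
apply: cvg_comp_at_right fv.2; last by near=> eps; rewrite mulr_gt0.
rewrite -[X in _ --> X](mulr0 k); apply: cvgM; first exact: cvg_cst.
by apply: cvg_at_right_filter; exact: cvg_id.
Unshelve. all: by end_near. Qed.

Lemma is_hilbert_homogeneous f x v p s : 0 < s ->
  (forall y, f (s * y) = s `^ p * f y) ->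
  is_hilbert f x v -> is_hilbert f (s * x) (s `^ p * v).
Proof.
move=> s0 fs fv; have s_neq0 := lt0r_neq0 s0.
have -> : f = fun y => s `^ p * f (s^-1 * y + 0).
  by apply/funext => y; rewrite -fs addr0 mulVKf.
apply: is_hilbertZ; apply: is_hilbert_affine; first by rewrite invr_gt0.
by rewrite mulKf// addr0.
Qed.

End hilbert_transform.

Section truncated_power.
Context {R : realType}.
Implicit Types (p s x y : R).

(* The truncated power x_+^p. *)
Definition tpowR p x : R := if 0 < x then x `^ p else 0.

Lemma tpowR_gt0 p x : 0 < x -> tpowR p x = x `^ p.
Proof. by rewrite /tpowR => ->. Qed.

Lemma tpowR_le0 p x : x <= 0 -> tpowR p x = 0.
Proof. by rewrite /tpowR leNgt => /negbTE ->. Qed.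

Lemma tpowR_ge0 p x : 0 <= tpowR p x.
Proof. by rewrite /tpowR; case: ifP => // _; exact: powR_ge0. Qed.

Lemma tpowRM p s x : 0 < s -> tpowR p (s * x) = s `^ p * tpowR p x.
Proof.
move=> s0; rewrite /tpowR pmulr_rgt0//; case: ifP => [x0|_]; last by rewrite mulr0.
by rewrite powRM// ltW.
Qed.

Lemma tpowRS p x : tpowR (p + 1) x = x * tpowR p x.
Proof.
rewrite /tpowR; case: ifP => [x0|_]; last by rewrite mulr0.
by rewrite powRD ?(gt_eqF x0) ?implybT// powRr1 ?ltW// mulrC.
Qed.

Lemma is_derive_tpowR p x : x != 0 -> is_derive x 1 (tpowR p) (p * tpowR (p - 1) x).
Proof.
case: ltgtP => // x0 _.
  rewrite tpowR_le0 ?ltW// mulr0; apply: (@near_eq_is_derive _ _ _ (cst 0)) => //.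
  by near=> y; rewrite tpowR_le0// ltW//; near: y; exact: lt_nbhsl.
rewrite tpowR_gt0//; apply: (@near_eq_is_derive _ _ _ (fun y => y `^ p)).
  by near=> y; rewrite tpowR_gt0//; near: y; exact: lt_nbhsr.
exact: is_derive1_powR.
Unshelve. all: by end_near. Qed.

Lemma tpowR_continuous p : 0 < p -> continuous (tpowR p).
Proof.
move=> p0 x; have [->|x0] := eqVneq x 0; last first.
  exact: is_derive1_continuous (is_derive_tpowR p x0).
apply/left_right_continuousP; rewrite tpowR_le0//; split.
  apply: (eq_cvg_at_left (@ltrN10 R) (f := cst 0) (g := tpowR p)); last exact: cvg_cst.
  by move=> y /andP[_ y0]; rewrite tpowR_le0// ltW.
apply: (eq_cvg_at_right ltr01 (f := fun y => y `^ p) (g := tpowR p)); last exact: powR_cvg0.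
by move=> y /andP[y0 _]; rewrite tpowR_gt0.
Qed.

Lemma has_integral_tpowR p x y : 0 < p -> x < y ->
  has_integral `]x, y[ (tpowR (p - 1)) ((tpowR p y - tpowR p x) / p).
Proof.
move=> p0 xy; have [y0|y0] := leP y 0.
  rewrite !tpowR_le0 ?(le_trans (ltW xy))// subrr mul0r.
  apply: has_integral0 => // z; rewrite /= in_itv/= => /andP[_ zy].
  by rewrite tpowR_le0// (le_trans (ltW zy)).
pose x' := Num.max x 0.
have x'y : x' < y by rewrite gt_max xy.
have -> : tpowR p x = tpowR p x'.
  by rewrite /x'; have [x0|//] := leP x 0; rewrite !tpowR_le0.
apply: (@has_integral_widen _ `]x', y[) => //.
- by apply: subset_itv; rewrite bnd_simp// le_max lexx.
- move=> z; rewrite /= !in_itv/= => /andP[xz zy] /negP.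
  by rewrite zy andbT gt_max xz/= -leNgt; exact: tpowR_le0.
rewrite mulrBl; apply: (ge0_FTC_oo (F := fun z => tpowR p z / p)) => //.
- move=> z /andP[]; rewrite gt_max => /andP[_ z0] _; have z_neq0 := lt0r_neq0 z0; split.
  + apply: is_derive_eq.
      exact: is_derive1M (is_derive_tpowR p z_neq0) (is_derive_cst p^-1 _ _).
    by rewrite /= mulr0 addr0 mulrC mulKf// gt_eqF.
  + exact: is_derive1_continuous (is_derive_tpowR _ z_neq0).
  + exact: tpowR_ge0.
- by apply: cvgM; [apply: cvg_at_right_filter; exact: tpowR_continuous|exact: cvg_cst].
- by apply: cvgM; [apply: cvg_at_left_filter; exact: tpowR_continuous|exact: cvg_cst].
Qed.

End truncated_power.

Section hilbert_tpowR.
Context {R : realType}.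
Variable m : R.
Hypothesis m01 : 0 < m < 1.
Implicit Types (x y r eps : R).

Let m0 : 0 < m. Proof. by case/andP: m01. Qed.
Let m1 : 0 < 1 - m. Proof. by case/andP: m01; rewrite subr_gt0. Qed.

Lemma tpowR_div_continuous p (w : R -> R) dw y : y != 0 -> w y != 0 ->
  is_derive y 1 w dw -> {for y, continuous (fun y => tpowR p y / w y)}.
Proof.
move=> y0 wy0 dwy.
exact: is_derive1_continuous (is_derive1M (is_derive_tpowR p y0) (is_derive1V wy0 dwy)).
Qed.

Lemma has_integral_tpowR_div1B_below r : 0 < r < 1 ->
  has_integral `]0, r[ (fun y => tpowR (- m) y / (1 - y)) (ibeta (1 - m) r).
Proof.
move=> /andP[r0 r1]; rewrite -[ibeta _ _]subr0.
apply: (ge0_FTC_oo (F := ibeta (1 - m))) => //.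
- move=> y /andP[y0 yr]; have y1 := lt_trans yr r1; split.
  + rewrite tpowR_gt0// (_ : _ `^ _ = y `^ (1 - m - 1)); last by congr (_ `^ _); ring.
    by apply: is_derive_ibeta; rewrite ?y0.
  + apply: tpowR_div_continuous (is_derive1_onem y); first exact: lt0r_neq0.
    by rewrite gt_eqF// subr_gt0.
  + by rewrite divr_ge0 ?tpowR_ge0// subr_ge0 ltW.
- exact: ibeta_cvg0.
- apply: cvg_at_left_filter; apply: is_derive1_continuous (is_derive_ibeta m1 _).
  by rewrite r0.
Qed.

Lemma powR_inv_div_sqr y : 0 < y -> y^-1 `^ (m - 1) / y ^+ 2 = y `^ (- m) / y.
Proof.
move=> y0; rewrite -[in LHS]powR_inv1 ?ltW// -powRrM mulN1r opprB.
rewrite (_ : 1 - m = - m + 1); last by ring.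
rewrite powRD ?(gt_eqF y0) ?implybT// powRr1 ?ltW//.
by field; rewrite gt_eqF.
Qed.

Lemma has_integral_tpowR_div1B_above r : 0 < r < 1 ->
  has_integral `]r^-1, +oo[ (fun y => tpowR (- m) y / (1 - y)) (- ibeta m r).
Proof.
move=> /andP[r0 r1]; have r1V : 1 < r^-1 by rewrite invf_gt1.
have -> : - ibeta m r = -1 * (ibeta m r - 0) by rewrite subr0 mulN1r.
apply: (@eq_has_integral _ _ (fun y => -1 * (tpowR (- m) y / (y - 1)))) => //.
  by move=> y _; rewrite mulN1r -mulrN -invrN opprB.
apply: has_integralZl => //.
apply: (ge0_FTC_oy_inv (G := ibeta m) (g := fun t => t `^ (m - 1) / (1 - t))) => //.
- by move=> t /andP[t0 tr]; apply: is_derive_ibeta; rewrite ?t0 ?(lt_trans tr).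
- move=> y ry; have y1 := lt_trans r1V ry; have y0 := lt_trans ltr01 y1.
  have yB1 : 0 < y - 1 by rewrite subr_gt0.
  split.
  + rewrite tpowR_gt0// mulrAC powR_inv_div_sqr//.
    by field; rewrite !gt_eqF//.
  + by apply: tpowR_div_continuous (is_derive1_addr (-1) y); rewrite gt_eqF.
  + by rewrite divr_ge0 ?tpowR_ge0// ltW.
- exact: ibeta_cvg0.
- apply: cvg_at_left_filter; apply: is_derive1_continuous (is_derive_ibeta m0 _).
  by rewrite r0.
Qed.

Lemma has_integral_tpowR_divD1 :
  has_integral `]0, +oo[ (fun y => tpowR (- m) y / (y + 1)) (pi / sin (pi * m)).
Proof.
have integrand_cont y : 0 < y -> {for y, continuous (fun y => tpowR (- m) y / (y + 1))}.
  move=> y0; apply: tpowR_div_continuous (is_derive1_addr 1 y); rewrite gt_eqF//.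
  by rewrite addr_gt0.
have integrand_ge0 y : 0 < y -> 0 <= tpowR (- m) y / (y + 1).
  by move=> y0; rewrite divr_ge0 ?tpowR_ge0// addr_ge0// ltW.
have lower : has_integral `]0, 1[ (fun y => tpowR (- m) y / (y + 1))
    (ibeta_lim1 ((1 - m) / 2) - ibeta_lim1 (1 - m) - ln 2 - 0).
  apply: (ge0_FTC_oo (F := ibeta_alt (1 - m))) => //.
  - move=> y /andP[y0 y1]; split; [|exact: integrand_cont|exact: integrand_ge0].
    rewrite tpowR_gt0// (_ : _ `^ _ = y `^ (1 - m - 1)); last by congr (_ `^ _); ring.
    by apply: is_derive_ibeta_alt; rewrite ?y0.
  - exact: ibeta_alt_cvg0.
  - exact: ibeta_alt_cvg.
have upper : has_integral `]1^-1, +oo[ (fun y => tpowR (- m) y / (y + 1))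
    (ibeta_lim1 (m / 2) - ibeta_lim1 m - ln 2 - 0).
  apply: (ge0_FTC_oy_inv (G := ibeta_alt m) (g := fun t => t `^ (m - 1) / (t + 1))) => //.
  - by move=> t t01; exact: is_derive_ibeta_alt.
  - rewrite invr1 => y y1; have y0 := lt_trans ltr01 y1.
    split; [|exact: integrand_cont|exact: integrand_ge0].
    rewrite tpowR_gt0// mulrAC powR_inv_div_sqr//.
    by field; rewrite !gt_eqF// addr_gt0.
  - exact: ibeta_alt_cvg0.
  - exact: ibeta_alt_cvg.
rewrite invr1 in upper; rewrite -ibeta_lim1_cosecant// addrC.
rewrite -[X in X + _]subr0 -[X in _ + X]subr0.
by apply: (has_integral_itv_cat (c := 1)) => //; rewrite in_itv/= ltr01.
Qed.

Lemma ibeta_PV_cvg :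
  (ibeta (1 - m) (1 - eps) - ibeta m (1 + eps)^-1) @[eps --> 0^'+] -->
  - (pi * cot (pi * m)).
Proof.
have id0 : eps @[eps --> (0 : R)^'+] --> 0 by apply: cvg_at_right_filter; exact: cvg_id.
have D1 : 1 + eps @[eps --> 0^'+] --> (1 : R).
  by rewrite -[X in _ --> X]addr0; apply: cvgD => //; exact: cvg_cst.
have B1 : 1 - eps @[eps --> 0^'+] --> (1 : R).
  by rewrite -[X in _ --> X]subr0; apply: cvgB => //; exact: cvg_cst.
have DV1 : (1 + eps)^-1 @[eps --> 0^'+] --> (1 : R).
  by rewrite -[X in _ --> X]invr1; apply: cvgV => //; exact: oner_neq0.
have lower : ibeta_reg (1 - m) (1 - eps) @[eps --> 0^'+] --> ibeta_lim1 (1 - m).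
  by apply: (cvg_comp_at_left B1) (ibeta_reg_cvg m1); near=> eps; rewrite gtrBl.
have upper : ibeta_reg m (1 + eps)^-1 @[eps --> 0^'+] --> ibeta_lim1 m.
  apply: (cvg_comp_at_left DV1) (ibeta_reg_cvg m0).
  by near=> eps; rewrite invf_lt1 ?ltrDl// addr_gt0.
have lnD : ln (1 + eps) @[eps --> 0^'+] --> (0 : R).
  by rewrite -[X in _ --> X](@ln1 R); apply: continuous_cvg => //; exact: continuous_ln.
rewrite -ibeta_lim1_reflection// opprB -[X in _ --> X]subr0.
apply: (eq_cvg_at_right ltr01
    (f := fun eps => ibeta_reg (1 - m) (1 - eps) - ibeta_reg m (1 + eps)^-1 - ln (1 + eps))).
  move=> eps /andP[eps0 _]; have D0 : 0 < 1 + eps by rewrite addr_gt0.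
  rewrite /ibeta_reg subKr (_ : 1 - (1 + eps)^-1 = eps / (1 + eps)).
    by rewrite ln_div ?posrE//; ring.
  by field; rewrite gt_eqF.
by apply: cvgB lnD; exact: cvgB lower upper.
Unshelve. all: by end_near. Qed.

Lemma is_hilbert_tpowR_1 : is_hilbert (tpowR (- m)) 1 (- cot (pi * m)).
Proof.
apply: (has_integral_is_hilbert ltr01 _ (I := fun eps =>
  ibeta (1 - m) (1 - eps) - ibeta m (1 + eps)^-1)); last first.
  by rewrite mulrN; exact: ibeta_PV_cvg.
move=> eps /andP[eps0 eps1].
have lower : 0 < 1 - eps < 1 by rewrite subr_gt0 eps1 gtrBl.
have upper : 0 < (1 + eps)^-1 < 1 by rewrite invr_gt0 invf_lt1 ?ltrDl ?addr_gt0// andbT.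
have above := has_integral_tpowR_div1B_above upper; rewrite invrK in above.
apply: (@has_integral_widen _ (`]0, 1 - eps[ `|` `]1 + eps, +oo[)); last first.
- apply: has_integralU (has_integral_tpowR_div1B_below lower) above => //.
  by apply/disj_setPS => y /= []; rewrite !in_itv/= andbT; lra.
- move=> y; rewrite /= !in_itv/= andbT => + nA; rewrite lter_normr => epsy.
  rewrite tpowR_le0 ?mul0r// leNgt; apply/negP => y0; apply: nA.
  by case/orP: epsy => [?|?]; [left|right]; lra.
- move=> y /=; rewrite !in_itv/= andbT lter_normr.
  by move=> [?|?]; apply/orP; [left|right]; lra.
- exact: measurable_truncation.
- exact: measurableU.
Qed.

Lemma is_hilbert_tpowR_N1 : is_hilbert (tpowR (- m)) (-1) (- (sin (pi * m))^-1).
Proof.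
apply: (has_integral_is_hilbert ltr01 _ (I := fun=> - (pi / sin (pi * m)))); last first.
  by rewrite mulrN; exact: cvg_cst.
move=> eps /andP[eps0 eps1].
apply: (@has_integral_widen _ `]0, +oo[) => //.
- exact: measurable_truncation.
- move=> y /=; rewrite in_itv/= andbT => y0.
  by rewrite lter_normr; apply/orP; right; lra.
- move=> y _; rewrite /= in_itv/= andbT => /negP; rewrite -leNgt => y0.
  by rewrite tpowR_le0// mul0r.
- apply: (@eq_has_integral _ _ (fun y => -1 * (tpowR (- m) y / (y + 1)))) => //.
    by move=> y _; rewrite mulN1r -mulrN -invrN opprD addrC.
  rewrite -[X in has_integral _ _ X]mulN1r.
  by apply: has_integralZl => //; exact: has_integral_tpowR_divD1.
Qed.

Lemma is_hilbert_tpowR x : x != 0 -> is_hilbert (tpowR (- m)) x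
  (- ((tpowR (- m) (- x) + cos (pi * m) * tpowR (- m) x) / sin (pi * m))).
Proof.
have powM s : 0 < s -> forall y, tpowR (- m) (s * y) = s `^ (- m) * tpowR (- m) y.
  by move=> s0 y; exact: tpowRM.
case: ltgtP => // x0 _.
- have Nx0 : 0 < - x by rewrite oppr_gt0.
  rewrite (tpowR_le0 _ (ltW x0)) mulr0 addr0 tpowR_gt0// -mulrN.
  have := is_hilbert_homogeneous Nx0 (powM _ Nx0) is_hilbert_tpowR_N1.
  by rewrite mulrN1 opprK.
- rewrite [tpowR _ (- x)]tpowR_le0 ?oppr_le0 ?ltW// add0r tpowR_gt0//.
  rewrite mulrAC [_ * x `^ _]mulrC -mulrN.
  have := is_hilbert_homogeneous x0 (powM _ x0) is_hilbert_tpowR_1.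
  by rewrite mulr1.
Qed.

End hilbert_tpowR.

Lemma oint_primitive (R : realType) (g G : R -> R) (x y : R) :
  (forall x y, x < y -> has_integral `]x, y[ g (G y - G x)) ->
  oint g x y = G y - G x.
Proof.
move=> gG; rewrite /oint; case: ltgtP => [xy|yx|<-].
- exact: (has_integral_itvcc xy (gG _ _ xy)).2.
- by rewrite (has_integral_itvcc yx (gG _ _ yx)).2 opprB.
- by rewrite set_itv1 Rintegral_set1 subrr.
Qed.

Section profile.
Context {R : realType}.
Variable a : R.
Hypothesis a_lt0 : a < 0.
Implicit Types (x y X : R).
Notation m := ((1 - a)^-1).
Notation Omega := (Omega_bar a).

Let a1 : 0 < 1 - a. Proof. by move: a_lt0; lra. Qed.

Let m01 : 0 < m < 1.
Proof. by rewrite invr_gt0 a1 invf_lt1//; move: a_lt0; lra. Qed.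

Let m1 : 0 < 1 - m. Proof. by rewrite subr_gt0; case/andP: m01. Qed.

Lemma Omega_barE X : Omega X = - sin (pi * m) * tpowR (- m) (X - 1).
Proof.
rewrite /Omega_bar /tpowR subr_gt0; case: ifP => [X1|_]; last by rewrite mul0r.
by rewrite div1r powRN distrC gtr0_norm// subr_gt0.
Qed.

Definition hilbert_Omega_bar X : R :=
  tpowR (- m) (1 - X) + cos (pi * m) * tpowR (- m) (X - 1).

Lemma hilbert_Omega_barE X : X != 1 -> hilbert_Omega_bar X =
  ((if X < 1 then 1 else 0) + (if 1 < X then 1 else 0) * cos (pi * m)) / `|1 - X| `^ m.
Proof.
rewrite /hilbert_Omega_bar; case: ltgtP => // X1 _.
- rewrite tpowR_gt0 ?subr_gt0// (tpowR_le0 _ (_ : X - 1 <= 0)) ?subr_le0 ?ltW//.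
  by rewrite mulr0 mul0r !addr0 div1r powRN gtr0_norm ?subr_gt0.
- rewrite (tpowR_le0 _ (_ : 1 - X <= 0)) ?subr_le0 ?ltW// tpowR_gt0 ?subr_gt0//.
  by rewrite mul1r !add0r powRN distrC gtr0_norm ?subr_gt0.
Qed.

Lemma is_hilbert_Omega_bar X : X != 1 -> is_hilbert Omega X (hilbert_Omega_bar X).
Proof.
move=> X1; have sin_neq0 := lt0r_neq0 (sin_pi_gt0 m01).
have -> : Omega = fun y => - sin (pi * m) * tpowR (- m) (1 * y + -1).
  by apply/funext => y; rewrite Omega_barE mul1r.
have -> : hilbert_Omega_bar X = - sin (pi * m) *
    - ((tpowR (- m) (- (X - 1)) + cos (pi * m) * tpowR (- m) (X - 1)) / sin (pi * m)).
  by rewrite mulrNN mulrC divfK// opprB.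
apply: is_hilbertZ; apply: (@is_hilbert_affine _ _ _ _ 1 (-1)) => //.
by rewrite mul1r; apply: is_hilbert_tpowR => //; rewrite subr_eq0.
Qed.

Definition hilbert_Omega_bar_primitive X : R :=
  (cos (pi * m) * tpowR (1 - m) (X - 1) - tpowR (1 - m) (1 - X)) / (1 - m).

Lemma has_integral_hilbert_Omega_bar x y : x < y ->
  has_integral `]x, y[ (hilbert Omega)
    (hilbert_Omega_bar_primitive y - hilbert_Omega_bar_primitive x).
Proof.
move=> xy.
apply: (@eq_has_integral_setD1 _ _ 1 hilbert_Omega_bar) => // [X _ X1|].
  by rewrite (is_hilbertE (is_hilbert_Omega_bar X1)).
have -> : hilbert_Omega_bar_primitive y - hilbert_Omega_bar_primitive x =
    (tpowR (1 - m) (1 - x) - tpowR (1 - m) (1 - y)) / (1 - m) +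
    cos (pi * m) * ((tpowR (1 - m) (y - 1) - tpowR (1 - m) (x - 1)) / (1 - m)).
  by rewrite /hilbert_Omega_bar_primitive; ring.
have power_integral u v : u < v -> has_integral `]u, v[ (tpowR (- m))
    ((tpowR (1 - m) v - tpowR (1 - m) u) / (1 - m)).
  move=> uv; rewrite (_ : tpowR (- m) = tpowR (1 - m - 1)); last by congr tpowR; ring.
  exact: has_integral_tpowR.
apply: has_integralD => //; last apply: has_integralZl => //.
- by apply: has_integral_itv_reflect; apply: power_integral; lra.
- by apply: has_integral_itv_shift; apply: power_integral; lra.
Qed.

Lemma U_barE X : U_bar a X = hilbert_Omega_bar_primitive X + (1 - m)^-1.
Proof.
rewrite /U_bar (oint_primitive _ _ has_integral_hilbert_Omega_bar); congr (_ + _).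
rewrite /hilbert_Omega_bar_primitive sub0r subr0 tpowR_le0 ?oppr_le0// tpowR_gt0// powR1.
by rewrite mulr0 sub0r mulN1r opprK.
Qed.

Lemma is_derive_tpowR_B1 p X : X != 1 ->
  is_derive X 1 (fun y => tpowR p (y - 1)) (p * tpowR (p - 1) (X - 1)).
Proof.
move=> X1; have dtpow : is_derive (X - 1) 1 (tpowR p) (p * tpowR (p - 1) (X - 1)).
  by apply: is_derive_tpowR; rewrite subr_eq0.
have dB1 := is_derive1_addr (-1) X.
by apply: is_derive_eq (is_derive1_chain (g := fun y => y - 1) dtpow dB1) _; rewrite mulr1.
Qed.

Lemma is_derive_tpowR_1B p X : X != 1 ->
  is_derive X 1 (fun y => tpowR p (1 - y)) (- (p * tpowR (p - 1) (1 - X))).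
Proof.
move=> X1; have dtpow : is_derive (1 - X) 1 (tpowR p) (p * tpowR (p - 1) (1 - X)).
  by apply: is_derive_tpowR; rewrite subr_eq0 eq_sym.
have d1B := is_derive1_onem X.
by apply: is_derive_eq (is_derive1_chain (g := fun y => 1 - y) dtpow d1B) _; rewrite mulrN1.
Qed.

Lemma is_derive_Omega_bar X : X != 1 ->
  is_derive X 1 Omega (sin (pi * m) * (m * tpowR (- m - 1) (X - 1))).
Proof.
move=> X1; rewrite (funext Omega_barE).
apply: is_derive_eq (is_derive1Zl (- sin (pi * m)) (is_derive_tpowR_B1 (- m) X1)) _.
by rewrite !mulNr mulrN opprK.
Qed.

Lemma is_derive_U_bar X : X != 1 -> is_derive X 1 (U_bar a) (hilbert_Omega_bar X).
Proof.
move=> X1; rewrite (funext U_barE).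
have dB := is_derive1Zl (cos (pi * m)) (is_derive_tpowR_B1 (1 - m) X1).
have dV := is_derive1M (is_derive1B dB (is_derive_tpowR_1B (1 - m) X1))
  (is_derive_cst (1 - m)^-1 X 1).
apply: is_derive_eq (is_derive1D dV (is_derive_cst (1 - m)^-1 X 1)) _.
rewrite (_ : 1 - m - 1 = - m); last by ring.
by rewrite /hilbert_Omega_bar /=; move: (1 - m) (lt0r_neq0 m1) => k k0; field.
Qed.

Lemma transport_speedE X :
  (1 - a) * X + a * U_bar a X = (1 - a) * (X - 1) * (1 - hilbert_Omega_bar X).
Proof.
rewrite U_barE /hilbert_Omega_bar_primitive /hilbert_Omega_bar [1 - m]addrC !tpowRS.
have -> : - m + 1 = - a / (1 - a) by field; rewrite gt_eqF.
by field; rewrite (lt_eqF a_lt0) (gt_eqF a1).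
Qed.

Lemma profile_equation X : X != 1 ->
  ((1 - a) * X + a * U_bar a X) * derive1 Omega X =
  (-1 + derive1 (U_bar a) X) * Omega X.
Proof.
move=> X1; rewrite (is_derive1_derive1 (is_derive_Omega_bar X1)).
rewrite (is_derive1_derive1 (is_derive_U_bar X1)) transport_speedE Omega_barE.
have -> : tpowR (- m) (X - 1) = (X - 1) * tpowR (- m - 1) (X - 1).
  by rewrite -tpowRS subrK.
by field; rewrite gt_eqF.
Qed.

End profile.

Unset Implicit Arguments.
Set Strict Implicit.

Theorem mainTheorem4 (R : realType) (a : R) (ha : a < 0) :
  let mu := (1 - a)^-1 in
  let cl := 1 - a in
  let cw := -1 : R in
  (forall X : R, X != 1 ->
     is_hilbert (Omega_bar a) X
       (((if X < 1 then 1 else 0) + (if 1 < X then 1 else 0) * cos (pi * mu))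
          / (`|1 - X| `^ mu))) /\
  (forall X : R, X != 1 ->
     derivable (Omega_bar a) X 1 /\ derivable (U_bar a) X 1 /\
     (cl * X + a * U_bar a X) * derive1 (Omega_bar a) X
       = (cw + derive1 (U_bar a) X) * Omega_bar a X).
Proof.
split=> X X1; first by rewrite -hilbert_Omega_barE//; exact: is_hilbert_Omega_bar.
have dOmega := is_derive_Omega_bar a X1.
have dU := is_derive_U_bar ha X1.
split; first exact: ex_derive.
by split; [exact: ex_derive|exact: profile_equation].
Qed.
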